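(* Let $d\ge 1$. (Bridges) Let $\widetilde X_1,\ldots,\widetilde X_{d+3}$ be (possibly dependent) random vectors in $\mathbb{R}^{d+1}$ with partial sums $\widetilde S_k=\widetilde X_1+\cdots+\widetilde X_k$, such that: (Ex) for every permutation $\sigma$ of $\{1,\ldots,d+3\}$, $(\widetilde X_{\sigma(1)},\ldots,\widetilde X_{\sigma(d+3)})$ has the same distribution as $(\widetilde X_1,\ldots,\widetilde X_{d+3})$; (Br) $\widetilde S_{d+3}=0$ with probability $1$; (GP') for every $1\le i_1<\cdots<i_{d+1}\le d+2$, the vectors $\widetilde S_{i_1},\ldots,\widetilde S_{i_{d+1}}$ are linearly independent with probability $1$. Let $\mathcal{C}^A_{d+3,d+1}=\mathrm{pos}\{\widetilde S_1,\ldots,\widetilde S_{d+3}\}=\mathrm{pos}\{\widetilde S_1,\ldots,\widetilde S_{d+2}\}$. Then, for all $m\in\{-1,0,\ldots,\lfloor d/2\rfloor\}$, $$ \mathbb{P}[\mathcal{C}_{d+3,d+1}^A\cap \mathbb{S}^d \text{ is of type } T_m^{d}] = \eta_{d,m} \cdot \frac{1}{(d+3)!}\left\langle {d+3\atop m+1}\right\rangle . $$ (Walks) Let $X_1,\ldots,X_{d+2}$ be (possibly dependent) random vectors in $\mathbb{R}^{d+1}$ with partial sums $S_k=X_1+\cdots+X_k$, such that: ($\pm$Ex) for every permutation $\sigma$ of $\{1,\ldots,d+2\}$ and every $(\varepsilon_1,\ldots,\varepsilon_{d+2})\in\{\pm1\}^{d+2}$, $(\varepsilon_1X_{\sigma(1)},\ldots,\varepsilon_{d+2}X_{\sigma(d+2)})$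 has the same distribution as $(X_1,\ldots,X_{d+2})$; (GP) for every $1\le i_1<\cdots<i_{d+1}\le d+2$, the vectors $S_{i_1},\ldots,S_{i_{d+1}}$ are linearly independent with probability $1$. Let $\mathcal{C}^B_{d+2,d+1}=\mathrm{pos}\{S_1,\ldots,S_{d+2}\}$. Then, for all $m\in\{-1,0,\ldots,\lfloor d/2\rfloor\}$, $$ \mathbb{P}[\mathcal{C}_{d+2,d+1}^B\cap \mathbb{S}^d \text{ is of type } T_m^{d}] = \eta_{d,m} \cdot \frac{1}{2^{d+2}(d+2)!}\, B\!\left\langle {d+2\atop m+1}\right\rangle . $$
   Context: $\mathrm{pos}$ denotes the positive hull: $\mathrm{pos}\{x_1,\ldots,x_n\}=\{\lambda_1x_1+\cdots+\lambda_nx_n:\lambda_1,\ldots,\lambda_n\ge0\}$. $\mathbb{S}^d$ is the unit sphere in $\mathbb{R}^{d+1}$. Eulerian numbers: $\left\langle {n\atop k}\right\rangle$, $k\in\{0,\ldots,n-1\}$, is the number of permutations of $\{1,\ldots,n\}$ in which exactly $k$ elements are greater than the previous element. The $B$-analogues $B\!\left\langle {n\atop k}\right\rangle$, $k\in\{0,\ldots,n\}$, are defined by $B\!\left\langle {n\atop k}\right\rangle=2^nA_{n,k,1/2}$, where $\sum_{j=0}^\infty (j+\frac12)^nx^j=\frac{\sum_{k=0}^nA_{n,k,1/2}x^k}{(1-x)^{n+1}}$ for $|x|<1$ (they count signed permutations of $\{1,\ldots,n\}$ with $k$ type-$B$ ascents). Types of spherical polytopes: let $C\subseteq\mathbb{R}^{d+1}$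 be the positive hull of $d+2$ vectors in general linear position (any $d+1$ of them are linearly independent) and $Q=C\cap\mathbb{S}^d$. Let $f_j(Q):=f_{j+1}(C)$ denote the number of $j$-dimensional faces of $Q$, i.e. of $(j+1)$-dimensional faces of the cone $C$. For $m\in\{-1,0,\ldots,\lfloor d/2\rfloor\}$, $Q$ is said to be of type $T_m^d$ if $f_{d-1}(Q)=(m+1)(d+1-m)$. In particular, $Q$ is of type $T_{-1}^d$ if $Q=\mathbb{S}^d$, of type $T_0^d$ if $Q$ is a spherical simplex, and otherwise $Q$ has $d+2$ vertices and is of one of the types $T_1^d,\ldots,T^d_{\lfloor d/2\rfloor}$. $\eta_{d,m}:=2$ if $m\ne d/2$, and $\eta_{d,m}:=1$ if $m=d/2$. *)

(* Defs.v *)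
From HB Require Import structures.
From mathcomp Require Import all_boot all_order all_fingroup all_algebra.
From mathcomp Require Import all_classical all_reals all_analysis.

Set Implicit Arguments.
Unset Strict Implicit.
Unset Printing Implicit Defensive.

Import Order.TTheory GRing.Theory Num.Theory.
Import numFieldNormedType.Exports.

Local Open Scope classical_set_scope.
Local Open Scope card_scope.
Local Open Scope ring_scope.

Section Cones.
Context {R : realType} {n : nat}.
Implicit Types (C F : set 'rV[R]_n).

Definition pos_hull {k : nat} (v : 'I_k -> 'rV[R]_n) : set 'rV[R]_n :=
  [set x | exists l : 'I_k -> R,
     (forall i, 0 <= l i) /\ x = \sum_(i < k) l i *: v i].

Definition dotv (u x : 'rV[R]_n) : R := \sum_(i < n) u 0 i * x 0 i.

(* Euclidean unit sphere; the library norm on row vectors is the sup norm. *)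
Definition unit_sphere : set 'rV[R]_n := [set x | dotv x x = 1].

Definition lin_indep {k : nat} (v : 'I_k -> 'rV[R]_n) : bool :=
  row_free (\matrix_(i < k) v i).

(* Faces of a polyhedral cone: intersections with supporting hyperplanes
   through 0; u = 0 gives the improper face C. *)
Definition is_face C F : Prop :=
  exists u : 'rV[R]_n,
    (forall y, C y -> 0 <= dotv u y) /\ F = C `&` [set x | dotv u x = 0].

(* The linear hull of F has dimension k: the rows of A lie in F and form a
   basis of it. *)
Definition has_dim F (k : nat) : Prop :=
  exists A : 'M[R]_(k, n),
    [/\ row_free A, forall i, F (row i A) & forall x, F x -> (x <= A)%MS].

Definition faces C (k : nat) : set (set 'rV[R]_n) :=
  [set F | is_face C F /\ has_dim F k].

End Cones.

Definition increasing_idx {k l : nat} (f : 'I_k -> 'I_l) : Prop :=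
  {homo f : i j / (i < j)%N}.

Definition general_position {R : realType} {d : nat}
    (v : 'I_d.+2 -> 'rV[R]_d.+1) : Prop :=
  forall f : 'I_d.+1 -> 'I_d.+2, increasing_idx f -> lin_indep (v \o f).

(* Q is of type T_m^d. By convention f_{d-1}(Q) is the number of d-dimensional
   faces of the cone C with Q = C `&` unit_sphere. It does not depend on the
   choice of v, because pos_hull v is recovered from Q as its positive hull. *)
Definition spherical_type {R : realType} (d : nat) (m : int)
    (Q : set 'rV[R]_d.+1) : Prop :=
  exists v : 'I_d.+2 -> 'rV[R]_d.+1,
    [/\ general_position v,
        Q = pos_hull v `&` unit_sphere
      & exists2 N : nat, faces (pos_hull v) d #= `I_N
          & N%:Z = (m + 1) * (d%:Z + 1 - m)].

Definition eta_mult (d : nat) (m : int) : nat :=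
  if m * 2 == d%:Z then 1%N else 2%N.

Definition ascents {n : nat} (s : 'S_n) : nat :=
  #|[pred ij : 'I_n * 'I_n |
       (nat_of_ord ij.2 == (nat_of_ord ij.1).+1) && (s ij.1 < s ij.2)%N]|.

Definition eulerian (n k : nat) : nat := #|[pred s : 'S_n | ascents s == k]|.

(* p = \sum_(k <= n) A_{n,k,1/2} 'X^k. *)
Definition is_eulerian_half {R : realType} (n : nat) (p : {poly R}) : Prop :=
  (size p <= n.+1)%N /\
  forall x : R, `|x| < 1 ->
    series (fun j : nat => (j%:R + 2^-1) ^+ n * x ^+ j) @ \oo
      --> p.[x] / (1 - x) ^+ n.+1.

Definition eulerian_half (R : realType) (n : nat) : {poly R} :=
  xget 0 [set p | is_eulerian_half n p].

Definition eulerianB (R : realType) (n k : nat) : R :=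
  2 ^+ n * (eulerian_half R n)`_k.

Definition borel_rV (R : realType) (n : nat) :=
  g_sigma_algebraType (@open 'rV[R]_n).

Section Random.
Context {disp : measure_display} {T : measurableType disp} {R : realType}.
Context {n d : nat}.
Implicit Types (X Y : 'I_n -> T -> 'rV[R]_d).

Definition random_vectors X : Prop :=
  forall i, measurable_fun setT (X i : T -> borel_rV R d).

Definition joint X (w : T) : n.-tuple (borel_rV R d) := [tuple X i w | i < n].

Definition same_law (P : probability T R) X Y : Prop :=
  forall B : set (n.-tuple (borel_rV R d)), measurable B ->
    pushforward P (joint X) B = pushforward P (joint Y) B.

Definition exchangeable (P : probability T R) X : Prop :=
  forall s : 'S_n, same_law P (fun i => X (s i)) X.

Definition sign_exchangeable (P : probability T R) X : Prop :=
  forall (s : 'S_n) (e : 'I_n -> bool),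
    same_law P (fun i w => (-1) ^+ e i *: X (s i) w) X.

(* X_1 + ... + X_k, where X_j is X applied to the ordinal of value j - 1. *)
Definition psum X (k : nat) (w : T) : 'rV[R]_d :=
  \sum_(i < n | (i < k)%N) X i w.

(* P[A] = p for the completion of P. General position only holds almost surely,
   so events are only described up to null sets; P itself is unspecified
   outside the sigma-algebra. *)
Definition has_prob (P : probability T R) (A : set T) (p : R) : Prop :=
  exists E : set T,
    [/\ measurable E, {ae P, forall w, A w <-> E w} & P E = p%:E].

End Random.

(* Main.v *)
(** Let v_1, ..., v_(d+2) be in general position in R^(d+1). Their linear relation
    is unique up to a scalar and has no zero coefficient; say p coefficients are
    positive and q negative. A hyperplane supporting a facet of pos(v) misses
    exactly two of the v_k, whose coefficients have opposite signs, so pos(v) has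
    p * q facets. Since p + q = d + 2, type T_m means {p, q} = {m+1, d+1-m}.

    If sum_j mu_j X_j = 0, summation by parts gives the relation
    sum_i (mu_i - mu_(i+1)) S_i = 0 between the partial sums, so that p or q is
    the number of descents of mu. A (signed) permutation of the steps permutes
    mu in the same way, without changing the distribution. The probability is
    therefore the proportion of (signed) permutations with m+1 or d+1-m
    descents; by the symmetry mu -> -mu this is eta times an Eulerian number.

    The B-Eulerian numbers, defined by a generating series, are identified with
    the descent counts of signed permutations by a recurrence (insertion of the
    largest letter) and the type B Worpitzky identity
    (2j+1)^n = sum_k B(n,k) C(j+n-k, n). *)

Require Import Defs.
From HB Require Import structures.
From mathcomp Require Import all_boot all_order all_fingroup all_algebra.
From mathcomp Require Import all_classical all_reals all_analysis.
From mathcomp Require Import measurable_realfun.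
From mathcomp Require Import zify lra ring.

Import Order.TTheory GRing.Theory Num.Theory.
Import numFieldNormedType.Exports.

Local Open Scope classical_set_scope.
Local Open Scope ring_scope.

(** * Descents of signed permutations *)

(** The [n] comparisons involve the [n + 1] terms [w 0] to [w n], so the value at [n] matters. *)
Definition des {R : realDomainType} (n : nat) (w : nat -> R) : nat :=
  (\sum_(0 <= i < n) (w i.+1 < w i)%R)%N.

Lemma des_le {R : realDomainType} n (w : nat -> R) : (des n w <= n)%N.
Proof.
rewrite -[leqRHS]muln1 -[X in (_ <= X * _)%N]subn0 -sum_nat_const_nat.
by apply: leq_sum => i _; case: (_ < _).
Qed.

Definition insert {A : Type} (a : A) (j : nat) (w : nat -> A) (i : nat) : A :=
  if (i < j)%N then w i else if i == j then a else w i.-1.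

(** The new entry exceeds all others in absolute value, so it is a peak or a valley. Inside the
    sequence one comparison gives way to two, exactly one of which is a descent: a descent slot
    keeps the count, any other slot raises it by one. In front, only the sign decides. As [j <= n],
    nothing is put after the terminal [w n]. *)
Lemma des_insert {R : realDomainType} n (w : nat -> R) (a : R) (s : bool) j :
  (forall i, `|w i| < a) -> (j <= n)%N ->
  des n.+1 (insert ((-1) ^+ s * a) j w) =
    (des n w + (if j is j'.+1 then ~~ (w j < w j')%R else ~~ s))%N.
Proof.
move=> wa jn; rewrite /des.
have Ma i : ((-1) ^+ s * a < w i) = s.
  have := wa i; rewrite ltr_norml => /andP[h1 h2].
  by case: s; rewrite ?expr1 ?expr0 ?mulN1r ?mul1r ?h1 // ltNge (ltW h2).
have aM i : (w i < (-1) ^+ s * a) = ~~ s.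
  have := wa i; rewrite ltr_norml => /andP[h1 h2].
  by case: s {Ma}; rewrite ?expr1 ?expr0 ?mulN1r ?mul1r ?h2 // ltNge (ltW h1).
case: j jn => [_|j jn].
  rewrite big_nat_recl // addnC; congr (_ + _)%N.
  by rewrite /insert /= aM.
rewrite (big_cat_nat _ (n := j)) ?(ltnW jn) //= ?(leqW (ltnW jn)) //.
rewrite [in RHS](big_cat_nat _ (n := j)) ?(ltnW jn) //=.
rewrite (@big_ltn _ _ _ j n.+1) ?(@big_ltn _ _ _ j.+1 n.+1) ?(@big_ltn _ _ _ j n) ?ltnS ?(ltnW jn) //.
rewrite big_add1 /=.
have -> : (\sum_(0 <= i < j) (insert ((-1) ^+ s * a) j.+1 w i.+1 <
    insert ((-1) ^+ s * a) j.+1 w i)%R = \sum_(0 <= i < j) (w i.+1 < w i)%R)%N.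
  rewrite !big_nat; apply: eq_bigr => i /andP[_ ij].
  by rewrite /insert ltnS ij (ltn_trans ij).
have -> : (\sum_(j.+1 <= i < n) (insert ((-1) ^+ s * a) j.+1 w i.+2 <
    insert ((-1) ^+ s * a) j.+1 w i.+1)%R =
    \sum_(j.+1 <= i < n) (w i.+1 < w i)%R)%N.
  rewrite !big_nat; apply: eq_bigr => i /andP[ij _].
  rewrite /insert.
  have -> : (i.+2 < j.+1)%N = false by lia.
  have -> : (i.+1 < j.+1)%N = false by lia.
  have -> : (i.+2 == j.+1) = false by lia.
  by have -> : (i.+1 == j.+1) = false by lia.
rewrite /insert ltnn ltnSn eqxx /= ltnNge leqnSn /= gtn_eqF // Ma aM.
by case: s {Ma aM}; case: (_ < _) => /=; lia.
Qed.

(* A signed permutation g = (s, e) acts on mu by (e_i mu_(s i)); the sequence is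
   continued by 0, which makes the sign of its last entry a descent statistic. *)
Definition signed_seq {R : realDomainType} {n} (mu : 'I_n -> R)
    (g : 'S_n * {ffun 'I_n -> bool}) (i : nat) : R :=
  if insub i is Some k then (-1) ^+ g.2 k * mu (g.1 k) else 0.

Definition signed_des {R : realDomainType} {n} (mu : 'I_n -> R) (k : nat) : nat :=
  #|[pred g | des n (signed_seq mu g) == k]|.

Definition abs_distinct {R : realDomainType} {n} (mu : 'I_n -> R) : Prop :=
  (forall i, mu i != 0) /\ injective (fun i => `|mu i|).

(* Coefficients counting signed permutations of n letters with k descents:
   the largest letter is inserted, with either sign, into one of n + 1 slots. *)
Fixpoint signed_eulerian (n k : nat) : nat :=
  if n is m.+1 then
    ((2 * k).+1 * signed_eulerian m k +
     (if k is l.+1 then (2 * (m - l)).+1 * signed_eulerian m l else 0))%N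
  else (k == 0%N).

(** [h.1] is the slot and the sign of the inserted letter [i0]; [h.2] is the signed permutation of
    the remaining letters. *)
Definition extend_signed {n} (i0 : 'I_n.+1)
    (h : ('I_n.+1 * bool) * ('S_n * {ffun 'I_n -> bool})) :
    'S_n.+1 * {ffun 'I_n.+1 -> bool} :=
  (lift_perm h.1.1 i0 h.2.1,
   [ffun i => if unlift h.1.1 i is Some k then h.2.2 k else h.1.2]).

Lemma extend_signed_bij n (i0 : 'I_n.+1) : bijective (extend_signed i0).
Proof.
apply: inj_card_bij; last first.
  rewrite !card_prod !card_Sn !card_ffun !card_bool !card_ord factS expnS.
  by rewrite leq_eqVlt; apply/orP; left; apply/eqP; ring.
move=> [[j b] [s e]] [[j' b'] [s' e']] /= [/permP E /ffunP F].
have jj : j = j'.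
  by apply: (@perm_inj _ (lift_perm j' i0 s')); rewrite -E !lift_perm_id.
subst j'.
congr (_, _, (_, _)).
- by have := F j; rewrite !ffunE unlift_none.
- apply/permP => k; apply: (@lift_inj _ i0).
  by have := E (lift j k); rewrite !lift_perm_lift.
- by apply/ffunP => k; have := F (lift j k); rewrite !ffunE !liftK.
Qed.

Lemma signed_seq_extend {R : realDomainType} n (mu : 'I_n.+1 -> R) i0 h i :
  signed_seq mu (extend_signed i0 h) i =
  insert ((-1) ^+ h.1.2 * mu i0) h.1.1 (signed_seq (fun k => mu (lift i0 k)) h.2) i.
Proof.
case: h => [[j b] [s e]] /=; rewrite /insert /signed_seq.
case: insubP => [k _ <-|] /=; last first.
  rewrite -leqNgt => ni; have jn := ltn_ord j.
  have -> : (i < j)%N = false by lia.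
  have -> : (i == j) = false by lia.
  by rewrite insubN // -leqNgt; lia.
rewrite ffunE; case: (unliftP j k) => [l|] -> /=.
  rewrite lift_perm_lift /= /bump.
  case: (leqP j l) => [jl|lj] /=.
    rewrite add1n ltnNge leqW //= gtn_eqF //= valK //.
  by rewrite add0n lj valK.
by rewrite lift_perm_id ltnn eqxx.
Qed.

Lemma signed_seq_lt {R : realDomainType} n (mu : 'I_n -> R) g (a : R) :
  0 < a -> (forall i, `|mu i| < a) -> forall i, `|signed_seq mu g i| < a.
Proof.
move=> a0 h i; rewrite /signed_seq; case: insubP => [k _ _|_]; last by rewrite normr0.
by rewrite normrM normrX normrN1 expr1n mul1r.
Qed.

Lemma sum_eqn_desc n k (w : nat -> bool) (D := (\sum_(0 <= i < n) w i)%N) :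
  (\sum_(0 <= i < n) (D + ~~ w i == k) = D * (D == k) + (n - D) * (D.+1 == k))%N.
Proof.
have cE : (\sum_(0 <= i < n) ~~ w i = n - D)%N.
  apply/eqP; rewrite -(eqn_add2r D) subnK; last first.
    rewrite -[leqRHS]muln1 -[X in (_ <= X * _)%N]subn0 -sum_nat_const_nat.
    by apply: leq_sum => i _; case: (w i).
  rewrite -big_split /= (eq_bigr (fun=> 1%N)); last by move=> i _; case: (w i).
  by rewrite sum_nat_const_nat subn0 muln1.
rewrite -cE {2}/D !big_distrl -big_split; apply: eq_bigr => i _ /=.
by case: (w i); rewrite /= ?addn0 ?addn1 ?mul1n ?mul0n.
Qed.

Lemma argmax_abs {R : realDomainType} n (mu : 'I_n.+1 -> R) : abs_distinct mu ->
  exists i0, (0 < `|mu i0|) /\ (forall k, `|mu (lift i0 k)| < `|mu i0|).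
Proof.
move=> [mu0 muI].
pose i0 := [arg max_(i > ord0) `|mu i|]%O; exists i0.
split=> [|k]; first by rewrite normr_gt0.
rewrite lt_neqAle; apply/andP; split.
  by apply/eqP => /muI /eqP; rewrite eq_sym (negPf (neq_lift _ _)).
by rewrite /i0; case: arg_maxP => // i _; apply.
Qed.

(** Induction removing the letter of largest absolute value. A signed permutation of the other [n]
    letters with D descents has 2D + 1 extensions with D descents and 2(n - D) + 1 with D + 1: both
    signs at each interior slot, and one sign each at the front. *)
Lemma signed_desE {R : realDomainType} n (mu : 'I_n -> R) k :
  abs_distinct mu -> signed_des mu k = signed_eulerian n k.
Proof.
elim: n mu k => [|n IH] mu k.
  move=> _; rewrite /signed_des /=.
  rewrite (eq_card (B := pred_of_simpl [pred _ | k == 0%N])); last first.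
    by move=> g; rewrite !inE /des big_nil eq_sym.
  case: eqP => k0; last by rewrite eq_card0.
  by rewrite eq_cardT // -cardT card_prod card_Sn card_ffun card_bool !card_ord.
move=> mud; have [i0 [a0 ma]] := argmax_abs n mu mud.
pose mu' := fun k => mu (lift i0 k).
have mud' : abs_distinct mu'.
  case: mud => m0 mI; split=> [i|i j /mI /lift_inj //]; exact: m0.
rewrite /signed_des -sum1_card big_mkcond /=.
rewrite (reindex _ (onW_bij _ (extend_signed_bij n i0))) /=.
rewrite -(pair_bigA _ (fun x y => if des n.+1 (signed_seq mu (extend_signed i0 (x, y))) == k then 1 else 0)%N) /=.
rewrite exchange_big /=.
have step g : (\sum_(x : 'I_n.+1 * bool)
    (if des n.+1 (signed_seq mu (extend_signed i0 (x, g))) == k then 1 else 0) =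
    (2 * k).+1 * (des n (signed_seq mu' g) == k) +
    (2 * (n.+1 - k)).+1 * ((des n (signed_seq mu' g)).+1 == k))%N.
  set w := signed_seq mu' g; set D := des n w.
  have wa : forall i, `|w i| < `|mu i0| by exact: signed_seq_lt.
  pose a := `|mu i0|.
  (* The sign of [mu i0] itself is absorbed into the inserted sign. *)
  pose t : bool := mu i0 < 0.
  have mE : mu i0 = (-1) ^+ t * a by rewrite /t /a {1}[mu i0]realEsign // num_real.
  have E (x : 'I_n.+1 * bool) :
    des n.+1 (signed_seq mu (extend_signed i0 (x, g))) =
      (D + (if val x.1 is j'.+1 then ~~ (w x.1 < w j')%R else ~~ (x.2 (+) t)))%N.
    rewrite -(@des_insert _ n w a (x.2 (+) t) x.1) //; last by rewrite -ltnS.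
    apply: eq_bigr => i _; rewrite !signed_seq_extend /= mE mulrA.
    by rewrite !signr_addb.
  rewrite (eq_bigr (fun x : 'I_n.+1 * bool => (D + (if val x.1 is j'.+1 then
      ~~ (w x.1 < w j')%R else ~~ (x.2 (+) t)) == k : nat)%N)); last first.
    by move=> x _; rewrite E; case: (_ == _).
  rewrite -(pair_bigA _ (fun (i : 'I_n.+1) b => (D + (if val i is j'.+1 then
      ~~ (w i < w j')%R else ~~ (b (+) t)) == k : nat)%N)) /=.
  rewrite big_ord_recl /= big_bool /=.
  under eq_bigr => i _ do rewrite big_bool /= /bump /= add1n addnn -mul2n.
  rewrite -big_distrr /= -(big_mkord xpredT (fun i => (D + ~~ (w i.+1 < w i)%R == k) : nat)%N).
  rewrite sum_eqn_desc -/(des n w) -/D.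
  have Dn : (D <= n)%N by exact: des_le.
  have -> : ((D + ~~ ~~ t == k) + (D + ~~ t == k) = (D == k) + (D.+1 == k))%N.
    by case: (t); rewrite /= ?addn0 ?addn1 // addnC.
  by case: (eqVneq D k) => [Dk|_]; case: (eqVneq D.+1 k) => [Dk'|_] /=; nia.
under eq_bigr => g _ do rewrite step.
rewrite big_split /= -!big_distrr /=.
have cE l : (\sum_(g : 'S_n * {ffun 'I_n -> bool}) (des n (signed_seq mu' g) == l) =
    signed_eulerian n l)%N.
  rewrite -(IH mu' l mud') /signed_des -sum1_card [RHS]big_mkcond.
  by apply: eq_bigr => g _; rewrite inE; case: (_ == _).
rewrite cE; congr (_ + _)%N; case: k {step} => [|l].
  by rewrite big1 ?muln0.
by rewrite -cE; under eq_bigr => g _ do rewrite eqSS.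
Qed.

(** * Descents of permutations *)

(** For [n.+1] letters, [des n] reads only indices in range: unlike for [signed_seq], the default 0
    never enters. *)
Definition perm_seq {R : realDomainType} {n} (mu : 'I_n -> R) (s : 'S_n) (i : nat) : R :=
  if insub i is Some k then mu (s k) else 0.

(** The rank counts the larger values, so [t] reverses the order and turns descents of [mu] into
    ascents. *)
Lemma exists_rank_perm {R : realDomainType} n (mu : 'I_n -> R) : injective mu ->
  exists t : 'S_n, forall i j, (mu j < mu i) = (t i < t j)%N.
Proof.
move=> muI.
pose r i := #|[pred k | mu i < mu k]|.
have rlt i : (r i < n)%N.
  rewrite -[X in (_ < X)%N]card_ord; apply: proper_card; apply/properP; split.
    exact: subset_predT.
  by exists i; rewrite // inE ltxx.
have rP i j : mu j < mu i -> (r i < r j)%N.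
  move=> ji; apply: proper_card; apply/properP; split.
    by apply/fintype.subsetP => k; rewrite !inE; exact: lt_trans.
  by exists i; rewrite inE ?ltxx.
pose f i := Ordinal (rlt i).
have fI : injective f.
  move=> i j [] rij; case: (ltgtP (mu i) (mu j)) => [||/muI //] /rP;
    by rewrite rij ltnn.
exists (perm fI) => i j; rewrite !permE /=; apply/idP/idP => [/rP //|].
by case: (ltgtP (mu j) (mu i)) => // [/rP|/muI ->]; rewrite ?ltnn // => h /ltn_trans/(_ h); rewrite ltnn.
Qed.

Lemma des_ascents {R : realDomainType} n (mu : 'I_n.+1 -> R) (t s : 'S_n.+1) :
  (forall i j, (mu j < mu i) = (t i < t j)%N) ->
  des n (perm_seq mu s) = ascents (s * t)%g.
Proof.
move=> h; rewrite /ascents -sum1_card big_mkcond /=.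
rewrite (eq_bigr (fun ij : 'I_n.+1 * 'I_n.+1 => if (nat_of_ord ij.2 == ij.1.+1)
  then ((s * t)%g ij.1 < (s * t)%g ij.2)%N : nat else 0%N)); last first.
  by move=> ij _; rewrite inE /=; case: (_ == _) => //=; case: (_ < _)%N.
rewrite -(pair_bigA _ (fun i j : 'I_n.+1 => if (nat_of_ord j == i.+1)
  then ((s * t)%g i < (s * t)%g j)%N : nat else 0%N)) /=.
rewrite big_ord_recr /= [X in (_ + X)%N]big1 ?addn0; last first.
  by move=> j _; rewrite ltn_eqF.
rewrite /des big_mkord; apply: eq_bigr => i _.
have i1 : (i.+1 < n.+1)%N by rewrite ltnS.
rewrite -big_mkcond /= (big_pred1 (Ordinal i1)) //=.
rewrite !permM -h /perm_seq insubT /=.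
have i0 : (i < n.+1)%N by rewrite ltnW.
rewrite insubT /=; congr (nat_of_bool (mu (s _) < mu (s _))); exact: val_inj.
Qed.

Lemma perm_desE {R : realDomainType} n (mu : 'I_n.+1 -> R) k : injective mu ->
  #|[pred s : 'S_n.+1 | des n (perm_seq mu s) == k]| = eulerian n.+1 k.
Proof.
move=> /exists_rank_perm[t ht].
rewrite /eulerian -!sum1_card [RHS](reindex_inj (mulIg t)) /=.
by apply: eq_bigl => s; rewrite !inE (des_ascents n mu t).
Qed.

(** * The generating series of the B-Eulerian numbers *)

Lemma signed_eulerian_gt n k : (n < k)%N -> signed_eulerian n k = 0%N.
Proof.
elim: n k => [|n IH] [|k] //= nk.
by rewrite !IH ?muln0 //; lia.
Qed.

Lemma worpitzky_signed n j :
  ((2 * j).+1 ^ n = \sum_(k < n.+1) signed_eulerian n k * 'C(j + (n - k), n))%N.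
Proof.
elim: n => [|n IH]; first by rewrite big_ord1 /= bin0.
(* This splitting mirrors the two terms of the recurrence of [signed_eulerian]. For [k > j] all
   three binomials vanish. *)
have E k : (k <= n)%N -> ((2 * j).+1 * 'C(j + (n - k), n) =
    (2 * k).+1 * 'C(j + (n.+1 - k), n.+1) +
    (2 * (n - k)).+1 * 'C(j + (n - k), n.+1))%N.
  move=> kn; rewrite subSn // addnS binS.
  have := mul_bin_left (j + (n - k)) n.
  case: (leqP k j) => jk; first by nia.
  by rewrite !bin_small //; lia.
rewrite expnS IH big_distrr /=.
rewrite (eq_bigr (fun k : 'I_n.+1 =>
    (2 * k).+1 * signed_eulerian n k * 'C(j + (n.+1 - k), n.+1) +
    (2 * (n - k)).+1 * signed_eulerian n k * 'C(j + (n - k), n.+1))%N); last first.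
  move=> k _; rewrite mulnCA E; last by rewrite -ltnS.
  by rewrite mulnDr mulnA [in X in (_ + X)%N]mulnA ![(signed_eulerian n k * _)%N]mulnC.
rewrite big_split /=.
under [in RHS]eq_bigr => k _ do rewrite mulnDl.
rewrite [in RHS]big_split /=; congr (_ + _)%N.
  by rewrite [in RHS]big_ord_recr /= signed_eulerian_gt // muln0 addn0.
by rewrite [in RHS]big_ord_recl /= mul0n add0n.
Qed.

Section Series.
Variable R : realType.
Implicit Types (x : R).

Definition bin_term (n : nat) x (j : nat) : R := 'C(j + n, n)%:R * x ^+ j.

(** Pascal's rule, telescoped; truncation at [N] leaves one boundary term. *)
Lemma series_bin_term n x N :
  (1 - x) * series (bin_term n.+1 x) N =
  series (bin_term n x) N - 'C(N + n, n.+1)%:R * x ^+ N.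
Proof.
rewrite /series /=; elim: N => [|N IH].
  by rewrite !big_nil bin_small // mul0r subr0 mulr0.
rewrite !big_nat_recr //= mulrDr IH /bin_term addnS addSn !binS !natrD exprS.
ring.
Qed.

Lemma series_bin_term_le n x N : 0 <= x -> x < 1 ->
  series (bin_term n x) N <= (1 - x)^-1 ^+ n.+1.
Proof.
move=> x0 x1; have y0 : 0 < 1 - x by rewrite subr_gt0.
elim: n => [|n IH].
  have -> : series (bin_term 0 x) N = series (geometric 1 x) N.
    by apply: eq_bigr => i _; rewrite /bin_term bin0.
  rewrite geometric_seriesE ?lt_eqF // expr1 /= mul1r ler_piMl ?invr_ge0 ?(ltW y0) //.
  by rewrite gerBl exprn_ge0.
rewrite exprS ler_pdivlMl // series_bin_term (le_trans _ IH) // gerBl.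
by rewrite mulr_ge0 ?exprn_ge0.
Qed.

(** At [|x|] the partial sums are monotone and bounded, so the series converges and its terms tend
    to 0. This disposes of the boundary term in [series_bin_term]. *)
Lemma bin_term_cvg0 n x : `|x| < 1 -> bin_term n x @ \oo --> (0 : R).
Proof.
move=> x1; apply/norm_cvg0P.
rewrite [X in X @ _ --> _](_ : _ = bin_term n `|x|); last first.
  by apply/funext => j /=; rewrite /bin_term normrM normrX ger0_norm.
apply: cvg_series_cvg_0; apply: nondecreasing_is_cvgn.
  apply/nondecreasing_seqP => N; rewrite /series /= big_nat_recr //= lerDl.
  by rewrite /bin_term mulr_ge0 ?exprn_ge0.
exists ((1 - `|x|)^-1 ^+ n.+1) => _ [N _ <-]; exact: series_bin_term_le.
Qed.

Lemma cvg_series_bin_term n x : `|x| < 1 ->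
  series (bin_term n x) @ \oo --> (1 - x)^-1 ^+ n.+1.
Proof.
move=> x1; have y0 : 1 - x != 0.
  by rewrite subr_eq0 eq_sym; apply: contraTneq x1 => ->; rewrite normr1 ltxx.
elim: n => [|n IH].
  have -> : series (bin_term 0 x) = series (geometric 1 x).
    by apply/funext => N; apply: eq_bigr => i _; rewrite /bin_term bin0.
  by rewrite expr1 -[X in _ --> X]mul1r; exact: cvg_geometric_series.
have -> : series (bin_term n.+1 x) = (fun N => (1 - x)^-1 *
    (series (bin_term n x) N - 'C(N + n, n.+1)%:R * x ^+ N)).
  by apply/funext => N; rewrite -series_bin_term mulKf.
rewrite exprS; apply: cvgMl_tmp; rewrite -[X in _ --> X]subr0; apply: cvgB => //.
(* The boundary term is squeezed by [bin_term n.+1], since C(N+n, n+1) is at most C(N+n+1, n+1). *)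
apply/norm_cvg0P; have h := bin_term_cvg0 n.+1 `|x|.
rewrite normr_id in h.
apply: (squeeze_cvgr _ (cvg_cst 0) (h x1)); near=> N.
rewrite normr_ge0 /= /bin_term normrM normrX ler_wpM2r ?exprn_ge0 // ger0_norm // ler_nat.
by rewrite addnS binS leq_addr.
Unshelve. all: by end_near. Qed.

(** The coefficients with [j < k] vanish: each induction step drops a zero first term and factors
    out [x]. *)
Lemma cvg_series_bin_shift n k x : `|x| < 1 -> (k <= n)%N ->
  series (fun j => 'C(j + (n - k), n)%:R * x ^+ j) @ \oo
    --> x ^+ k / (1 - x) ^+ n.+1.
Proof.
move=> x1; elim: k => [_|k IH kn].
  by rewrite subn0 expr0 mul1r -exprVn; exact: cvg_series_bin_term.
rewrite -cvg_shiftS.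
rewrite [X in X @ _ --> _](_ : _ = (fun N => x *
    series (fun j => 'C(j + (n - k), n)%:R * x ^+ j) N)); last first.
  apply/funext => N; rewrite /series /= big_nat_recl //= bin_small ?mul0r ?add0r; last lia.
  rewrite big_distrr /=; apply: eq_bigr => j _.
  by rewrite exprS mulrCA; congr (_ * ('C(_, _)%:R * _)); lia.
by rewrite exprS -mulrA; apply: cvgMl_tmp; apply: IH; rewrite ltnW.
Qed.

Definition signed_eulerian_poly n : {poly R} :=
  \poly_(k < n.+1) (2^-1 ^+ n * (signed_eulerian n k)%:R).

(** Write j + 1/2 as (2j + 1)/2, expand its power by [worpitzky_signed], and sum the shifted
    binomial series. *)
Lemma signed_eulerian_polyP n : is_eulerian_half n (signed_eulerian_poly n).
Proof.
split=> [|x x1]; first exact: size_poly.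
rewrite [X in X @ _ --> _](_ : _ = (fun N => \sum_(k < n.+1)
    (2^-1 ^+ n * (signed_eulerian n k)%:R) *
    series (fun j => 'C(j + (n - k), n)%:R * x ^+ j) N)); last first.
  apply/funext => N; rewrite /series /=.
  under [RHS]eq_bigr => k _ do rewrite big_distrr.
  rewrite exchange_big /=; apply: eq_bigr => j _.
  have -> : j%:R + 2^-1 = 2^-1 * ((2 * j).+1)%N%:R :> R.
    by rewrite -(natr1 (2 * j)) natrM mulrDr mulr1 mulKf.
  rewrite exprMn -natrX worpitzky_signed natr_sum mulr_sumr mulr_suml.
  by apply: eq_bigr => k _; rewrite natrM !mulrA.
rewrite horner_poly mulr_suml; apply: cvg_big => [|k _]; first exact: add_continuous.
rewrite -mulrA; apply: cvgMl_tmp; apply: cvg_series_bin_shift => //.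
by rewrite -ltnS.
Qed.

(** Uniqueness of limits makes [p] and [q] agree at the n + 1 points 1/2, ..., 1/(n+2) of the open
    unit interval, while their degrees are at most n. *)
Lemma is_eulerian_half_unique n (p q : {poly R}) :
  is_eulerian_half n p -> is_eulerian_half n q -> p = q.
Proof.
move=> [sp hp] [sq hq]; apply/eqP; rewrite -subr_eq0; apply/eqP.
pose rs : seq R := [seq (k.+2%:R)^-1 | k <- iota 0 n.+1].
apply: (@roots_geq_poly_eq0 _ _ rs).
- apply/allP => _ /mapP[k _ ->].
  have y1 : `|(k.+2%:R)^-1 : R| < 1.
    by rewrite ger0_norm ?invr_ge0 // invf_lt1 ?ltr1n // ltr0n.
  have y0 : (1 - (k.+2%:R)^-1 : R) != 0.
    by rewrite subr_eq0 eq_sym lt_eqF // (le_lt_trans (ler_norm _)).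
  have D0 : (1 - (k.+2%:R)^-1 : R) ^- n.+1 != 0 by rewrite invr_eq0 expf_neq0.
  have e : p.[(k.+2%:R)^-1] = q.[(k.+2%:R)^-1].
    apply: (mulIf D0).
    exact: (cvg_unique (@norm_hausdorff _ _) (hp _ y1) (hq _ y1)).
  by rewrite rootE hornerD hornerN e subrr.
- rewrite map_inj_uniq ?iota_uniq // => i j /invr_inj /eqP.
  by rewrite eqr_nat !eqSS => /eqP.
- rewrite size_map size_iota (leq_trans (size_polyD _ _)) // size_polyN.
  by rewrite geq_max sp sq.
Qed.

Lemma eulerianBE n k : eulerianB R n k = (signed_eulerian n k)%:R.
Proof.
have -> : eulerianB R n k = 2 ^+ n * (signed_eulerian_poly n)`_k.
  rewrite /eulerianB; congr (_ * _`_k); 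
  apply: (congr1 val (is_eulerian_half_unique n _ _ _ (signed_eulerian_polyP n))).
  by apply: (xgetPex 0); exists (signed_eulerian_poly n); exact: signed_eulerian_polyP.
rewrite coef_poly; case: ltnP => kn; last by rewrite signed_eulerian_gt ?mulr0.
by rewrite exprVn mulVKf // expf_neq0.
Qed.

End Series.

(** * Facets of a cone on d + 2 generators in general position *)

Section Dotv.
Context {R : realType} {n : nat}.
Implicit Types (u x : 'rV[R]_n).

Lemma dotvE u x : dotv u x = (x *m u^T) 0 0.
Proof. by rewrite mxE; apply: eq_bigr => i _; rewrite mxE mulrC. Qed.

Lemma dotv_sum u k (l : 'I_k -> R) (v : 'I_k -> 'rV[R]_n) :
  dotv u (\sum_i l i *: v i) = \sum_i l i * dotv u (v i).
Proof.
rewrite dotvE mulmx_suml summxE; apply: eq_bigr => i _.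
by rewrite -scalemxAl mxE -dotvE.
Qed.

Lemma dotvZ (a : R) x : dotv (a *: x) (a *: x) = a ^+ 2 * dotv x x.
Proof. by rewrite mulr_sumr; apply: eq_bigr => i _; rewrite !mxE; ring. Qed.

Lemma dotv_ge0 x : 0 <= dotv x x.
Proof. by apply: sumr_ge0 => i _; rewrite -expr2 sqr_ge0. Qed.

Lemma dotv_eq0 x : dotv x x = 0 -> x = 0.
Proof.
move=> /eqP; rewrite psumr_eq0 => [/allP h|i _]; last by rewrite -expr2 sqr_ge0.
apply/rowP => i; have := h i (mem_index_enum _).
by rewrite -expr2 sqrf_eq0 => /eqP ->; rewrite mxE.
Qed.

Lemma pos_hull_scale k (v : 'I_k -> 'rV[R]_n) a x :
  0 <= a -> pos_hull v x -> pos_hull v (a *: x).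
Proof.
move=> a0 [l [l0 ->]]; exists (fun i => a * l i); split=> [i|]; first exact: mulr_ge0.
by rewrite scaler_sumr; apply: eq_bigr => i _; rewrite scalerA.
Qed.

Lemma pos_hull0 k (v : 'I_k -> 'rV[R]_n) : pos_hull v 0.
Proof. by exists (fun=> 0); split=> //; rewrite big1 // => i _; rewrite scale0r. Qed.

Lemma pos_hull_gen k (v : 'I_k -> 'rV[R]_n) i : pos_hull v (v i).
Proof.
exists (fun j => (j == i)%:R); split=> [j|]; first by rewrite ler0n.
rewrite (bigD1 i) //= eqxx scale1r big1 ?addr0 // => j /negPf ->.
by rewrite scale0r.
Qed.

(** By normalising vectors, a cone is recovered from its trace on the sphere; the type is thus
    independent of the chosen generators. *)
Lemma pos_hull_sphere_sub k l (v : 'I_k -> 'rV[R]_n) (w : 'I_l -> 'rV[R]_n) :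
  pos_hull v `&` unit_sphere `<=` pos_hull w -> pos_hull v `<=` pos_hull w.
Proof.
move=> h x vx; have [x0|x0] := eqVneq (dotv x x) 0.
  by rewrite (dotv_eq0 _ x0); exact: pos_hull0.
have sx : 0 < Num.sqrt (dotv x x) by rewrite sqrtr_gt0 lt_neqAle eq_sym x0 dotv_ge0.
rewrite -[x](scalerKV (lt0r_neq0 sx)); apply: pos_hull_scale; first exact: ltW.
apply: h; split; first by apply: pos_hull_scale => //; rewrite invr_ge0 ltW.
rewrite /unit_sphere /= dotvZ exprVn sqr_sqrtr ?dotv_ge0 //; exact: mulVf.
Qed.

End Dotv.

Section Cone.
Local Open Scope card_scope.
Context {R : realType} {d : nat}.
Variable v : 'I_d.+2 -> 'rV[R]_d.+1.

Definition gens : 'M[R]_(d.+2, d.+1) := \matrix_i v i.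

(** Signed maximal minors: explicit coefficients of the linear relation between the generators,
    polynomial in the coordinates and hence measurable. *)
Definition cramer (i : 'I_d.+2) : R := (-1) ^+ i * \det (row' i gens).

Lemma cramer_rel : \sum_i cramer i *: v i = 0.
Proof.
apply/rowP => c; rewrite mxE summxE.
(* Repeating column [c] gives a zero determinant; its expansion along the repeated column is
   coordinate [c] of the relation. *)
pose A : 'M[R]_(d.+2) := row_mx (col c gens) gens.
have detA : \det A = 0.
  rewrite -det_tr; apply: (@determinant_alternate _ _ _ (lshift d.+1 (0 : 'I_1)) (rshift 1 c)).
    by rewrite eq_lrshift.
  by move=> i; rewrite !mxE (unsplitK (inl _)) (unsplitK (inr _)) !mxE.
rewrite -{2}detA (expand_det_col _ (lshift d.+1 (0 : 'I_1))); apply: eq_bigr => i _.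
rewrite row_mxEl !mxE mulrC; congr (_ * _).
rewrite /cofactor /cramer /= addn0; congr (_ * \det _).
apply/matrixP => a b; rewrite !mxE.
have -> : lift (lshift d.+1 (0 : 'I_1)) b = rshift 1 b by apply: val_inj.
by rewrite (unsplitK (inr _)) mxE.
Qed.

Lemma unit_cramer i : (row' i gens \in unitmx) = (cramer i != 0).
Proof. by rewrite unitmxE unitfE /cramer mulf_eq0 signr_eq0. Qed.

Lemma lin_indep_cramer i : lin_indep (v \o lift i) = (cramer i != 0).
Proof.
rewrite -unit_cramer -row_free_unit; congr row_free.
by apply/matrixP => a b; rewrite !mxE.
Qed.

Hypothesis cramer_neq0 : forall i, cramer i != 0.

(** Subtracting the multiple that cancels coefficient 0 leaves a relation between d + 1 independent
    vectors. *)
Lemma relation_cramer (a : 'I_d.+2 -> R) : \sum_i a i *: v i = 0 ->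
  exists c, forall i, a i = c * cramer i.
Proof.
move=> ra; pose c := a 0 / cramer 0; exists c => i.
pose b k := a k - c * cramer k.
have b0 : b 0 = 0 by rewrite /b /c divfK ?subrr.
have rb : \sum_k b k *: v k = 0.
  transitivity (\sum_k a k *: v k - c *: \sum_k cramer k *: v k); last first.
    by rewrite ra cramer_rel scaler0 subr0.
  rewrite scaler_sumr -sumrB.
  by apply: eq_bigr => k _; rewrite scalerBl scalerA.
have : \row_k b (lift 0 k) *m row' 0 gens = 0.
  rewrite -[RHS]rb [RHS]big_ord_recl b0 scale0r add0r mulmx_sum_row.
  apply: eq_bigr => k _; rewrite mxE; congr (_ *: _).
  by apply/rowP => l; rewrite !mxE.
move=> /(congr1 (mulmx^~ (invmx (row' 0 gens)))).
rewrite mulmxK ?unit_cramer // mul0mx => /rowP h.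
apply/eqP; rewrite -subr_eq0 -/(b i); case: (unliftP 0 i) => [k|] ->; last exact/eqP.
by have := h k; rewrite !mxE => ->.
Qed.

Lemma dual_vec i j : i != j ->
  exists u, dotv u (v i) = 1 /\ forall k, k != i -> k != j -> dotv u (v k) = 0.
Proof.
case: (unliftP j i) => [i'|] -> //; last by rewrite eqxx.
move=> _; have Mu : row' j gens \in unitmx by rewrite unit_cramer.
pose u : 'rV[R]_d.+1 := (invmx (row' j gens) *m delta_mx i' 0)^T.
have E k : dotv u (v (lift j k)) = (k == i')%:R.
  rewrite dotvE /u trmxK.
  have -> : v (lift j k) = row k (row' j gens) by apply/rowP => l; rewrite !mxE.
  by rewrite -row_mul mulKVmx // !mxE andbT.
exists u; split=> [|k]; first by rewrite E eqxx.
by case: (unliftP j k) => [k'|] ->; rewrite ?eqxx // (inj_eq lift_inj) E => /negPf ->.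
Qed.

Lemma dotv_rel u : \sum_i cramer i * dotv u (v i) = 0.
Proof. by rewrite -dotv_sum cramer_rel /dotv big1 // => i _; rewrite mxE mulr0. Qed.

(** Only two terms of the relation survive pairing with [u]; so [u] can be positive on both
    generators only if their coefficients have opposite signs. *)
Lemma dotv_rel2 u i j : i != j -> (forall k, k != i -> k != j -> dotv u (v k) = 0) ->
  cramer i * dotv u (v i) + cramer j * dotv u (v j) = 0.
Proof.
move=> ij h; rewrite -[RHS](dotv_rel u) (bigD1 i) //= (bigD1 j) 1?eq_sym //=.
by rewrite big1 ?addr0 // => k /andP[ki kj]; rewrite h // mulr0.
Qed.

(** Keeping all d + 2 coefficients, two of them zero, avoids reindexing the remaining generators. *)
Definition facet (i j : 'I_d.+2) : set 'rV[R]_d.+1 :=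
  [set x | exists l : 'I_d.+2 -> R,
     [/\ forall k, 0 <= l k, l i = 0, l j = 0 & x = \sum_k l k *: v k]].

Lemma face_facet u i j : i != j -> 0 < dotv u (v i) -> 0 < dotv u (v j) ->
  (forall k, k != i -> k != j -> dotv u (v k) = 0) ->
  pos_hull v `&` [set x | dotv u x = 0] = facet i j.
Proof.
move=> ij ui uj uk; rewrite predeqE => x; split.
  move=> [[l [l0 ->]]] /=; rewrite dotv_sum (bigD1 i) //= (bigD1 j) 1?eq_sym //=.
  rewrite big1 ?addr0 => [|k /andP[ki kj]]; last by rewrite uk // mulr0.
  move=> /eqP; rewrite paddr_eq0 ?mulr_ge0 ?(ltW ui) ?(ltW uj) //.
  rewrite !mulf_eq0 (gt_eqF ui) (gt_eqF uj) !orbF => /andP[/eqP li /eqP lj].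
  by exists l.
move=> [l [l0 li lj ->]]; split; first by exists l.
rewrite /= dotv_sum big1 // => k _.
have [->|ki] := eqVneq k i; first by rewrite li mul0r.
have [->|kj] := eqVneq k j; first by rewrite lj mul0r.
by rewrite uk // mulr0.
Qed.

Lemma facet_vec i j : 0 < cramer i -> cramer j < 0 ->
  exists u, [/\ 0 < dotv u (v i), 0 < dotv u (v j) &
    forall k, k != i -> k != j -> dotv u (v k) = 0].
Proof.
move=> ci cj; have ij : i != j by apply: contraTneq cj => <-; rewrite -leNgt ltW.
have [u [ui uk]] := dual_vec _ _ ij; exists u; split=> //; first by rewrite ui ltr01.
have := dotv_rel2 _ _ _ ij uk; rewrite ui mulr1 => e.
rewrite -(nmulr_rlt0 _ cj); lra.
Qed.

(** The generators lying in a facet determine the pair it misses; this gives injectivity in the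
    count of facets. *)
Lemma facet_gen i j k : 0 < cramer i -> cramer j < 0 ->
  facet i j (v k) <-> (k != i) && (k != j).
Proof.
move=> ci cj; have ij : i != j by apply: contraTneq cj => <-; rewrite -leNgt ltW.
have [u [ui uj uk]] := facet_vec _ _ ci cj.
rewrite -(face_facet u) //; split=> [[_] /= h|/andP[ki kj]].
  by apply/andP; split; apply: contra_eq_neq h => ->; rewrite gt_eqF.
by split; [exact: pos_hull_gen|exact: uk].
Qed.

Lemma has_dim_facet i j : i != j -> has_dim (facet i j) d.
Proof.
case: (unliftP i j) => [j'|] ->; last by rewrite eqxx.
move=> _; exists (row' j' (row' i gens)); split.
- have Mu : row' i gens \in unitmx by rewrite unit_cramer.
  apply/row_freeP; exists (invmx (row' i gens) *m (row' j' 1%:M)^T).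
  rewrite -[row' j' _ in LHS]mul1mx.
  have -> : row' j' (row' i gens) = row' j' 1%:M *m row' i gens.
    by rewrite !row'Esub mul_rowsub_mx mul1mx.
  rewrite mul1mx mulmxA mulmxK //; apply/matrixP => a b.
  rewrite !mxE (bigD1 (lift j' a)) //= !mxE eqxx mul1r (inj_eq lift_inj) eq_sym.
  by rewrite big1 ?addr0 // => k /negPf h; rewrite !mxE eq_sym h mul0r.
- move=> k; exists (fun l => (l == lift i (lift j' k))%:R); split=> [l|||].
  + by rewrite ler0n.
  + by rewrite (negPf (neq_lift _ _)).
  + by rewrite (inj_eq lift_inj) (negPf (neq_lift _ _)).
  + rewrite (bigD1 (lift i (lift j' k))) //= eqxx scale1r big1 ?addr0.
      by apply/rowP => l; rewrite !mxE.
    by move=> l /negPf ->; rewrite scale0r.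
- move=> x [l [_ li lj ->]]; apply: summx_sub => k _.
  case: (unliftP i k) => [k1|] ->; last by rewrite li scale0r sub0mx.
  case: (unliftP j' k1) => [k2|] ->; last by rewrite lj scale0r sub0mx.
  apply: scalemx_sub; apply: (eq_row_sub k2); apply/rowP => b.
  by rewrite !mxE.
Qed.

Lemma facet_faces i j : 0 < cramer i -> cramer j < 0 ->
  faces (pos_hull v) d (facet i j).
Proof.
move=> ci cj; have ij : i != j by apply: contraTneq cj => <-; rewrite -leNgt ltW.
split; last exact: has_dim_facet.
have [u [ui uj uk]] := facet_vec _ _ ci cj.
exists u; split; last by rewrite (face_facet u i j).
move=> y [l [l0 ->]]; rewrite dotv_sum; apply: sumr_ge0 => k _.
rewrite mulr_ge0 //.
have [->|ki] := eqVneq k i; first exact: ltW.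
have [->|kj] := eqVneq k j; first exact: ltW.
by rewrite uk.
Qed.

(** Let [K] index the generators orthogonal to [u]. They span the face, so at least d of them exist
    and at most two generators are missed. Missing fewer than two is impossible by [nK], and
    [dotv_rel2] gives the opposite signs. *)
Lemma faces_facet F : faces (pos_hull v) d F ->
  exists i j, [/\ 0 < cramer i, cramer j < 0 & F = facet i j].
Proof.
move=> [[u [u_ge0 FE]] [A [Afree FA AF]]].
have rA : \rank A = d by exact/eqP.
have uv k : 0 <= dotv u (v k) by apply: u_ge0; exact: pos_hull_gen.
pose K := [set k | dotv u (v k) == 0]%SET.
have KP k : (k \in K) = (dotv u (v k) == 0) by rewrite inE.
have dK : (d <= #|K|)%N.
  have : (A <= \sum_(k in K) <<v k>>)%MS.
    apply/row_subP => i; have := FA i; rewrite FE => -[[l [l0 ->]]] /=.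
    rewrite dotv_sum => /eqP; rewrite psumr_eq0 => [/allP h|k _]; last exact: mulr_ge0.
    apply: summx_sub => k _; have [kK|kK] := boolP (k \in K).
      by apply: scalemx_sub; apply: (sumsmx_sup k) => //; rewrite genmxE.
    have := h k (mem_index_enum _); rewrite /= mulf_eq0 -KP (negPf kK) orbF => /eqP ->.
    by rewrite scale0r sub0mx.
  move=> /mxrankS; rewrite rA => /leq_trans -> //.
  rewrite -sum1_card; apply: (big_ind2 (fun (B : 'M[R]_(d.+1)) (r : nat) => \rank B <= r)%N).
  - by rewrite mxrank0.
  - move=> B r C t hB hC; apply: leq_trans (leq_add hB hC).
    exact: mxrank_adds_leqif.
  - by move=> k _; rewrite mxrank_gen rank_leq_row.
(* Otherwise [u] kills d + 1 independent vectors, so [u = 0] and the face is the whole cone, of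
   dimension d + 1. *)
have nK j : ~ forall k, k != j -> k \in K.
  move=> h; have u0 : u = 0.
    apply: trmx_inj; rewrite trmx0.
    have Mu : row' j gens \in unitmx by rewrite unit_cramer.
    rewrite -(mulKmx Mu u^T); suff -> : row' j gens *m u^T = 0 by rewrite mulmx0.
    apply/colP => k; rewrite [RHS]mxE.
    have := h (lift j k); rewrite eq_sym neq_lift => /(_ isT).
    rewrite KP => /eqP <-; rewrite dotvE !mxE.
    by apply: eq_bigr => l _; rewrite !mxE.
  have : (row' 0 gens <= A)%MS.
    apply/row_subP => k; apply: AF; rewrite FE; split.
      have -> : row k (row' 0 gens) = v (lift 0 k) by apply/rowP => l; rewrite !mxE.
      exact: pos_hull_gen.
    by rewrite /= u0 /dotv big1 // => l _; rewrite mxE mul0r.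
  by move=> /mxrankS; rewrite mxrank_unit ?unit_cramer // rA ltnn.
have KC : (#|K| + #|~: K|%SET = d.+2)%N by rewrite cardsC card_ord.
have inK k : (k \in ~: K)%SET = (k \notin K) by rewrite inE.
have /cards2P[i [j [ij KE]]] : #|~: K|%SET == 2.
  case cE : #|~: K|%SET => [|[|[|c]]] //; last by lia.
    exfalso; apply: (nK 0) => k _; move/eqP: cE; rewrite cards_eq0 => /eqP cE.
    by apply: negbNE; rewrite -inK cE inE.
  move/eqP: cE => /cards1P[j cE]; exfalso; apply: (nK j) => k kj.
  by apply: negbNE; rewrite -inK cE inE.
have uk k : k != i -> k != j -> dotv u (v k) = 0.
  move=> /negPf ki /negPf kj; apply/eqP; rewrite -KP; apply: negbNE.
  by rewrite -inK KE !inE ki kj.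
have ui : 0 < dotv u (v i) by rewrite lt_neqAle eq_sym -KP -inK KE !inE eqxx uv.
have uj : 0 < dotv u (v j) by rewrite lt_neqAle eq_sym -KP -inK KE !inE eqxx orbT uv.
have := dotv_rel2 _ _ _ ij uk.
have := cramer_neq0 i; rewrite neq_lt => /orP[] ci e; last first.
  exists i, j; split=> //; last by rewrite FE (face_facet u i j).
  rewrite -(pmulr_llt0 _ uj); have := mulr_gt0 ci ui; lra.
have ji : j != i by rewrite eq_sym.
exists j, i; split=> //.
  rewrite -(pmulr_lgt0 _ uj); have : cramer i * dotv u (v i) < 0 by rewrite pmulr_llt0.
  lra.
by rewrite FE (face_facet u j i) // => k kj ki; exact: uk.
Qed.

Lemma card_faces : faces (pos_hull v) d #=
  `I_(#|[pred i | (0 < cramer i)%R]| * #|[pred i | (cramer i < 0)%R]|).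
Proof.
pose A := [pred ij : 'I_d.+2 * 'I_d.+2 | (0 < cramer ij.1) && (cramer ij.2 < 0)].
have cA : (#|[pred i | (0 < cramer i)%R]| * #|[pred i | (cramer i < 0)%R]|)%N = #|A|.
  by rewrite -cardX; apply: eq_card => -[i j]; rewrite !inE.
pose G (t : 'I_#|A|) := facet (enum_val t).1 (enum_val t).2.
have -> : faces (pos_hull v) d = G @` setT.
  rewrite predeqE => F; split.
    move=> /faces_facet[i [j [ci cj ->]]].
    have ijA : (i, j) \in A by rewrite inE /= ci.
    by exists (enum_rank_in ijA (i, j)) => //; rewrite /G enum_rankK_in.
  move=> [t _ <-]; have := enum_valP t; rewrite inE => /andP[ci cj].
  exact: facet_faces.
rewrite cA (card_eql (inj_card_eq _)); first by rewrite card_eq_sym card_II.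
move=> s t _ _ FE; apply: enum_val_inj.
have := enum_valP s; have := enum_valP t; rewrite /G in FE.
case: (enum_val s) (enum_val t) FE => i j [i' j'] /= FE.
rewrite !inE /= => /andP[ci' cj'] /andP[ci cj].
(* Equal facets miss the same two generators; the signs of the coefficients tell which comes
   first. *)
have key k : ((k != i) && (k != j)) = ((k != i') && (k != j')).
  apply/idP/idP.
    by rewrite -(facet_gen i j) // FE => h; rewrite -(facet_gen i' j').
  by rewrite -(facet_gen i' j') // -FE => h; rewrite -(facet_gen i j).
have := key i; have := key j; rewrite !eqxx andbF /=.
have -> : (i != j') by apply: contraTneq ci => ->; rewrite -leNgt ltW.
have -> : (j != i') by apply: contraTneq cj => ->; rewrite -leNgt ltW.
by rewrite andbT /= => /esym/negbFE/eqP -> /esym/negbFE/eqP ->.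
Qed.

End Cone.

Lemma general_position_cramer {R : realType} d (v : 'I_d.+2 -> 'rV[R]_d.+1) i :
  general_position v -> cramer v i != 0.
Proof.
move=> h; rewrite -lin_indep_cramer; apply: h => a b ab /=.
by rewrite /bump; case: (leqP i a); case: (leqP i b); lia.
Qed.

(** With p + q = d + 2, the equation pq = a(d + 2 - a) forces p to be a or d + 2 - a. *)
Lemma spherical_typeP {R : realType} d (v : 'I_d.+2 -> 'rV[R]_d.+1) (a : nat) (m : int) :
  general_position v -> m + 1 = a%:Z -> (a <= d.+2)%N ->
  spherical_type m (pos_hull v `&` unit_sphere) <->
  (#|[pred i | (0 < cramer v i)%R]| == a) || (#|[pred i | (0 < cramer v i)%R]| == d.+2 - a)%N.
Proof.
move=> gp ma ad.
have v0 i : cramer v i != 0 by exact: general_position_cramer.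
set p := #|_|; pose q := #|[pred i | (cramer v i < 0)%R]|.
have pq : (p + q = d.+2)%N.
  rewrite -[RHS]card_ord -(cardC [pred i | (0 < cramer v i)%R]); congr (_ + _)%N.
  by apply: eq_card => i; rewrite !inE -leNgt lt_neqAle v0.
have cF := card_faces v v0; rewrite -/p -/q in cF.
have mE : m = a%:Z - 1 by lia.
split=> [[w [wgp QE [N cN NE]]]|h].
  have hE : pos_hull w = pos_hull v.
    by apply/seteqP; split; apply: pos_hull_sphere_sub; [rewrite -QE|rewrite QE] => x [].
  rewrite hE in cN.
  have : (p * q)%N = N by apply/card_eq_II; rewrite -(card_eql cF); exact: cN.
  by rewrite mE in NE; nia.
exists v; split=> //; exists (p * q)%N => //.
by rewrite mE; case/orP: h => /eqP h; nia.
Qed.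

(** * Linear relations between partial sums *)

Lemma abel_sum {R : pzRingType} {V : lmodType R} (a : nat -> R) (x : nat -> V) N :
  \sum_(0 <= i < N) (a i - a i.+1) *: \sum_(0 <= j < i.+1) x j =
  \sum_(0 <= i < N) a i *: x i - a N *: \sum_(0 <= j < N) x j.
Proof.
elim: N => [|N IH]; first by rewrite !big_nil scaler0 subr0.
rewrite !(big_nat_recr N) //= IH scalerBl !scalerDr.
rewrite -!addrA; congr (_ + _); rewrite !addrA addNr add0r.
by rewrite opprD.
Qed.

Lemma des_card {R : realDomainType} N (w : nat -> R) :
  des N w = #|[pred i : 'I_N | w i.+1 < w i]|.
Proof.
rewrite /des big_mkord -sum1_card [RHS]big_mkcond; apply: eq_bigr => i _.
by rewrite inE; case: (_ < _).
Qed.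

Lemma desN {R : realDomainType} N (w : nat -> R) :
  (forall i, (i < N)%N -> w i != w i.+1) ->
  des N (fun i => - w i) = (N - des N w)%N.
Proof.
move=> h; rewrite !des_card -[X in (X - _)%N]card_ord.
rewrite -(cardC [pred i : 'I_N | w i.+1 < w i]) addKn; apply: eq_card => i.
by rewrite !inE ltrN2 -leNgt lt_neqAle h.
Qed.

Lemma eq_of_steps {A : eqType} N (a : nat -> A) :
  (forall i, (i < N)%N -> a i = a i.+1) -> forall i, (i <= N)%N -> a i = a N.
Proof.
move=> h i iN; elim: N h iN => [|N IH] h; first by rewrite leqn0 => /eqP ->.
rewrite leq_eqVlt => /predU1P[-> //|iN]; rewrite -h //; apply: IH => // k kN.
by apply: h; exact: ltnW.
Qed.

(** For [t <= N] this is unchanged when [b] is complemented, hence insensitive to the sign of the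
    linear relation. *)
Definition type_count {N} (t : nat) (b : 'I_N -> bool) : bool :=
  (#|b| == t) || (#|b| == N - t)%N.

Section Signs.
Context {R : realType} {d : nat} (x : nat -> 'rV[R]_d.+1) (a : nat -> R).
Let v (k : 'I_d.+2) := \sum_(0 <= j < k.+1) x j.
Hypothesis v0 : forall i, cramer v i != 0.
(** This form covers both models: for a walk [a d.+2] is 0, and for a bridge the first d + 2 steps
    sum to minus the last step. *)
Hypothesis abel : \sum_(0 <= i < d.+2) a i *: x i = a d.+2 *: \sum_(0 <= j < d.+2) x j.
Hypothesis a_neq : ~ forall i, (i < d.+2)%N -> a i = a i.+1.

(* The successive differences of a are proportional to the Cramer relation,
   with an uncontrolled sign; hence the symmetrised count. *)
Lemma diff_cramer : exists2 c, c != 0 & forall i : 'I_d.+2, a i - a i.+1 = c * cramer v i.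
Proof.
have [|c cE] := relation_cramer v v0 (fun i => a i - a i.+1).
  rewrite -(big_mkord xpredT (fun i => (a i - a i.+1) *: \sum_(0 <= j < i.+1) x j)).
  by rewrite abel_sum abel subrr.
exists c => //; apply/eqP => c0; apply: a_neq => i iN.
by apply/eqP; rewrite -subr_eq0 (cE (Ordinal iN)) c0 mul0r.
Qed.

Lemma steps_neq i : (i < d.+2)%N -> a i != a i.+1.
Proof.
move=> iN; have [c c0 /(_ (Ordinal iN)) /= cE] := diff_cramer.
by rewrite -subr_eq0 cE mulf_neq0.
Qed.

Lemma type_count_des t : (t <= d.+2)%N ->
  type_count t (fun i => 0 < cramer v i) = (des d.+2 a == t) || (des d.+2 a == d.+2 - t)%N.
Proof.
move=> tN; have [c c0 cE] := diff_cramer; rewrite /type_count.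
have dE i : (a i.+1 < a i) = (0 < a i - a i.+1) by rewrite subr_gt0.
move: c0; rewrite neq_lt => /orP[] c0.
  have -> : #|fun i => 0 < cramer v i| = (d.+2 - des d.+2 a)%N.
    rewrite -desN; last exact: steps_neq.
    rewrite des_card; apply: eq_card => i; rewrite !inE ltrN2.
    by rewrite -subr_lt0 cE nmulr_rlt0.
  have := des_le d.+2 a; lia.
suff -> : #|fun i => 0 < cramer v i| = des d.+2 a by [].
by rewrite des_card; apply: eq_card => i; rewrite !inE dE cE pmulr_rgt0.
Qed.

End Signs.

(** The two events coincide if 2t = N. Otherwise they are disjoint, and negation, which preserves
    the descent counts, exchanges them. This is the source of the factor eta. *)
Lemma card_sym_des {R : realDomainType} {G : finType} N (a : G -> nat -> R) (b : nat -> nat) t :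
  (t <= N)%N -> (forall g i, (i < N)%N -> a g i != a g i.+1) ->
  (forall k, #|[pred g | des N (a g) == k]| = b k) ->
  (forall k, #|[pred g | des N (fun i => - a g i) == k]| = b k) ->
  #|[pred g | (des N (a g) == t) || (des N (a g) == N - t)%N]| =
    ((if (t * 2 == N)%N then 1 else 2) * b t)%N.
Proof.
move=> tN an bE bNE; case: eqP => tt.
  rewrite mul1n -bE; apply: eq_card => g; rewrite !inE.
  have -> : (N - t = t)%N by lia.
  by rewrite orbb.
have -> : (2 * b t = #|[pred g | des N (a g) == t]| + #|[pred g | des N (a g) == N - t]|)%N.
  rewrite mul2n -addnn bE -{2}bNE; congr (_ + _)%N; apply: eq_card => g; rewrite !inE.
  by rewrite desN; [have := des_le N (a g); lia|exact: an].
rewrite -cardUI [X in (_ + X)%N]eq_card0 ?addn0 => [|g]; last by rewrite !inE; lia.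
by apply: eq_card => g; rewrite !inE.
Qed.

Lemma sum_insub {V : nmodType} n (f : 'I_n -> V) m : (m <= n)%N ->
  \sum_(0 <= j < m) (if insub j is Some k then f k else 0) = \sum_(i < n | (i < m)%N) f i.
Proof.
move=> mn; rewrite big_mkord (big_ord_narrow mn); apply: eq_bigr => i _.
rewrite insubT ?(leq_trans (ltn_ord i)) // => h; congr f; exact: val_inj.
Qed.

Definition partial_sums {R : realType} {n d e} (x : 'I_n -> 'rV[R]_d) (k : 'I_e) : 'rV[R]_d :=
  \sum_(i < n | (i < k.+1)%N) x i.

Definition nat_seq {V : nmodType} {n} (x : 'I_n -> V) (j : nat) : V :=
  if insub j is Some k then x k else 0.

Lemma partial_sumsE {R : realType} {n d e} (x : 'I_n -> 'rV[R]_d) : (e <= n)%N ->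
  partial_sums x = (fun k : 'I_e => \sum_(0 <= j < k.+1) nat_seq x j).
Proof.
move=> en; apply/funext => k.
by rewrite sum_insub // (leq_trans _ en).
Qed.

Lemma sum_nat_seq {V : nmodType} n (x : 'I_n -> V) :
  \sum_(0 <= j < n) nat_seq x j = \sum_i x i.
Proof. by rewrite sum_insub //; apply: eq_bigl => i; rewrite ltn_ord. Qed.

Lemma nat_seq_ord {V : nmodType} n (x : 'I_n -> V) (i : 'I_n) : nat_seq x i = x i.
Proof. by rewrite /nat_seq valK. Qed.

Lemma nat_seq_out {V : nmodType} n (x : 'I_n -> V) : nat_seq x n = 0.
Proof. by rewrite /nat_seq insubF ?ltnn. Qed.

Lemma exists_perm01 n (i j : 'I_n.+2) : i != j ->
  exists s : 'S_n.+2, s 0 = i /\ s (lift 0 0) = j.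
Proof.
move=> ij; pose j' := tperm 0 i j.
have j'0 : j' != 0.
  apply: contra ij => /eqP e; apply/eqP/(@perm_inj _ (tperm 0 i)).
  by rewrite tpermR -/j' e.
exists (tperm (lift 0 0) j' * tperm 0 i)%g; rewrite !permM tpermL; split.
  have -> : tperm (lift 0 0) j' 0 = 0 by rewrite tpermD.
  by rewrite tpermL.
by rewrite /j' tpermK.
Qed.

(** * Type counts over the signed permutations of a walk *)

Section Walk.
Context {R : realType} {d : nat} (x : 'I_d.+2 -> 'rV[R]_d.+1).
Let G := ('S_d.+2 * {ffun 'I_d.+2 -> bool})%type.

Definition signed_act (g : G) (i : 'I_d.+2) : 'rV[R]_d.+1 := (-1) ^+ g.2 i *: x (g.1 i).

Hypothesis gp : forall (g : G) (i : 'I_d.+2), cramer (partial_sums (signed_act g)) i != 0.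

Lemma card_walk_type t : (t <= d.+2)%N ->
  #|[pred g : G | type_count t (fun i => 0 < cramer (partial_sums (signed_act g)) i)]| =
    ((if (t * 2 == d.+2)%N then 1 else 2) * signed_eulerian d.+2 t)%N.
Proof.
move=> tN.
pose g1 : G := (1%g, [ffun=> false]).
have act1 : signed_act g1 = x.
  by apply/funext => i; rewrite /signed_act ffunE expr0 scale1r perm1.
pose lam i := cramer (partial_sums x) i.
have lam0 i : lam i != 0 by rewrite /lam -act1; exact: gp.
(* Tail sums invert the summation by parts: successive differences give back [lam], and the sequence
   ends in 0. *)
pose m0 j := \sum_(j <= i < d.+2) nat_seq lam i.
pose mu (i : 'I_d.+2) := m0 i.
have m0S (i : 'I_d.+2) : m0 i - m0 i.+1 = lam i.
  by rewrite /m0 big_ltn // addrK nat_seq_ord.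
have m0N : m0 d.+2 = 0 by rewrite /m0 big_geq.
have mu_rel : \sum_i mu i *: x i = 0.
  rewrite -[RHS](cramer_rel (partial_sums x)) -/lam.
  have := abel_sum m0 (nat_seq x) d.+2; rewrite m0N scale0r subr0 !big_mkord => E.
  rewrite (eq_bigr (fun i : 'I_d.+2 => m0 i *: nat_seq x i)); last first.
    by move=> i _; rewrite nat_seq_ord.
  rewrite -E; apply: eq_bigr => i _; rewrite m0S; congr (_ *: _).
  by rewrite (partial_sumsE x (leqnn _)).
have seqE g : signed_seq mu g = nat_seq (fun i => (-1) ^+ g.2 i * mu (g.1 i)) by [].
have seq_ord g (i : 'I_d.+2) : signed_seq mu g i = (-1) ^+ g.2 i * mu (g.1 i).
  by rewrite seqE nat_seq_ord.
have seq_out g : signed_seq mu g d.+2 = 0 by rewrite seqE nat_seq_out.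
have abelg g : \sum_(0 <= i < d.+2) signed_seq mu g i *: nat_seq (signed_act g) i =
    signed_seq mu g d.+2 *: \sum_(0 <= j < d.+2) nat_seq (signed_act g) j.
  rewrite seq_out scale0r big_mkord -[RHS]mu_rel.
  rewrite [RHS](reindex_inj (@perm_inj _ g.1)) /=; apply: eq_bigr => i _.
  rewrite seq_ord nat_seq_ord scalerA mulrAC -signr_addb addbb mul1r //.
have nconst g : ~ forall i, (i < d.+2)%N -> signed_seq mu g i = signed_seq mu g i.+1.
  move=> /eq_of_steps h.
  have mu0 i : mu i = 0.
    apply/eqP; rewrite -(mulrI_eq0 _ (@lreg_sign _ (g.2 (g.1^-1%g i)))).
    have := h (g.1^-1%g i) (ltnW (ltn_ord _)); rewrite seq_ord seq_out permKV => ->.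
    by rewrite eqxx.
  have := lam0 ord_max; rewrite -m0S /= m0N subr0.
  by rewrite -[m0 _]/(mu ord_max) mu0 eqxx.
have gpE g i : cramer (fun k : 'I_d.+2 => \sum_(0 <= j < k.+1) nat_seq (signed_act g) j) i != 0.
  by rewrite -(partial_sumsE (signed_act g) (leqnn d.+2)).
have stp g i : (i < d.+2)%N -> signed_seq mu g i != signed_seq mu g i.+1.
  exact: (steps_neq _ _ (gpE g) (abelg g) (nconst g)).
(* Consecutive terms differ for every group element. Moving i to the last place gives [mu i != 0];
   moving i and j to the first two places, with equal or opposite signs, separates the absolute
   values. *)
have mud : abs_distinct mu.
  split=> [i|i j /eqP].
    have := stp (tperm i ord_max, [ffun=> false]) d.+1 (leqnn _); rewrite seq_out.
    by rewrite (seq_ord _ ord_max) /= ffunE expr0 mul1r tpermR.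
  apply: contraTeq => ij; have [s [s0 s1]] := exists_perm01 _ _ _ ij.
  rewrite eqr_norm2 negb_or; apply/andP; split.
    have := stp (s, [ffun=> false]) 0 isT.
    rewrite (seq_ord _ 0) (seq_ord _ (lift 0 0)) /= !ffunE !mul1r s0 s1 //.
  have := stp (s, [ffun k => k != 0]) 0 isT.
  rewrite (seq_ord _ 0) (seq_ord _ (lift 0 0)) !ffunE eqxx.
  by rewrite (_ : (lift 0 0 != 0) = true) // expr0 expr1 mul1r mulN1r s0 s1.
have muNd : abs_distinct (fun i => - mu i).
  by case: mud => m1 m2; split=> [i|i j]; rewrite ?oppr_eq0 // !normrN; exact: m2.
rewrite -(card_sym_des _ (signed_seq mu) (signed_eulerian d.+2) t tN) => [|g i|k|k].
- apply: eq_card => g; rewrite !inE (partial_sumsE (signed_act g) (leqnn _)).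
  exact: (type_count_des _ _ (gpE g) (abelg g) (nconst g)).
- exact: stp.
- exact: signed_desE.
- rewrite -(signed_desE _ (fun i => - mu i)) //; apply: eq_card => g; rewrite !inE.
  congr (des _ _ == _); apply/funext => i; rewrite /signed_seq.
  by case: insub => [k'|]; rewrite ?mulrN ?oppr0.
Qed.

End Walk.

(** * Type counts over the permutations of a bridge *)

Section Bridge.
Context {R : realType} {d : nat} (x : 'I_d.+3 -> 'rV[R]_d.+1).

Hypothesis sum0 : \sum_i x i = 0.
Hypothesis gp : forall (s : 'S_d.+3) (i : 'I_d.+2), cramer (partial_sums (x \o s)) i != 0.

Lemma card_bridge_type t : (t <= d.+2)%N ->
  #|[pred s : 'S_d.+3 | type_count t (fun i => 0 < cramer (partial_sums (x \o s)) i)]| =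
    ((if (t * 2 == d.+2)%N then 1 else 2) * eulerian d.+3 t)%N.
Proof.
move=> tN.
have act1 : x \o (1%g : 'S_d.+3) = x by apply/funext => i /=; rewrite perm1.
pose lam (i : 'I_d.+2) := cramer (partial_sums x) i.
have lam0 i : lam i != 0 by rewrite /lam -act1; exact: gp.
pose m0 j := \sum_(j <= i < d.+2) nat_seq lam i.
(* There are d + 3 letters here; the last one has coefficient 0. *)
pose mu (i : 'I_d.+3) := m0 i.
have m0S (i : 'I_d.+2) : m0 i - m0 i.+1 = lam i.
  by rewrite /m0 big_ltn // addrK nat_seq_ord.
have m0N : m0 d.+2 = 0 by rewrite /m0 big_geq.
have mu_rel : \sum_i mu i *: x i = 0.
  rewrite -[RHS](cramer_rel (partial_sums x)) -/lam.
  have := abel_sum m0 (nat_seq x) d.+2; rewrite m0N scale0r subr0 => E.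
  rewrite (eq_bigr (fun i : 'I_d.+3 => m0 i *: nat_seq x i)); last first.
    by move=> i _; rewrite nat_seq_ord.
  rewrite -(big_mkord xpredT (fun i => m0 i *: nat_seq x i)) big_nat_recr //=.
  rewrite m0N scale0r addr0 -E big_mkord; apply: eq_bigr => i _.
  by rewrite m0S; congr (_ *: _); rewrite (partial_sumsE x (leqnSn _)).
have seq_ord s (i : 'I_d.+3) : perm_seq mu s i = mu (s i) by exact: nat_seq_ord.
have abelg (s : 'S_d.+3) : \sum_(0 <= i < d.+2) perm_seq mu s i *: nat_seq (x \o s) i =
    perm_seq mu s d.+2 *: \sum_(0 <= j < d.+2) nat_seq (x \o s) j.
  (* Both the steps and the relation sum to 0 over all d + 3 indices; isolating the last index gives
     the claim. *)
  have e1 : \sum_(0 <= j < d.+3) nat_seq (x \o s) j = 0.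
    by rewrite sum_nat_seq -[RHS]sum0 [RHS](reindex_inj (@perm_inj _ s)).
  have e2 : \sum_(0 <= i < d.+3) perm_seq mu s i *: nat_seq (x \o s) i = 0.
    rewrite big_mkord -[RHS]mu_rel [RHS](reindex_inj (@perm_inj _ s)) /=.
    by apply: eq_bigr => i _; rewrite seq_ord nat_seq_ord.
  move: e1 e2; rewrite !(big_nat_recr d.+2) //= => /eqP; rewrite addr_eq0 => /eqP ->.
  by move/eqP; rewrite addr_eq0 scalerN => /eqP.
have nconst s : ~ forall i, (i < d.+2)%N -> perm_seq mu s i = perm_seq mu s i.+1.
  move=> /eq_of_steps h.
  have muc i : mu i = perm_seq mu s d.+2.
    have iN : (s^-1%g i <= d.+2)%N by rewrite -ltnS.
    by rewrite -(h _ iN) seq_ord permKV.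
  have := lam0 0; rewrite -m0S.
  by rewrite -[m0 _]/(mu 0) -[m0 _]/(mu (lift 0 0)) !muc subrr eqxx.
have gpE (s : 'S_d.+3) i :
    cramer (fun k : 'I_d.+2 => \sum_(0 <= j < k.+1) nat_seq (x \o s) j) i != 0.
  by rewrite -(partial_sumsE (x \o s) (leqnSn d.+2)).
have stp s i : (i < d.+2)%N -> perm_seq mu s i != perm_seq mu s i.+1.
  exact: (steps_neq _ _ (gpE s) (abelg s) (nconst s)).
have muI : injective mu.
  move=> i j /eqP; apply: contraTeq => ij; have [s [s0 s1]] := exists_perm01 _ _ _ ij.
  by have := stp s 0 isT; rewrite (seq_ord _ 0) (seq_ord _ (lift 0 0)) s0 s1.
rewrite -(card_sym_des _ (perm_seq mu) (eulerian d.+3) t tN) => [|s i|k|k].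
- apply: eq_card => s; rewrite !inE (partial_sumsE (x \o s) (leqnSn _)).
  exact: (type_count_des _ _ (gpE s) (abelg s) (nconst s)).
- exact: stp.
- exact: perm_desE.
- have muNI : injective (fun i => - mu i) by move=> i j /oppr_inj /muI.
  rewrite -(perm_desE _ (fun i => - mu i)) //; apply: eq_card => s; rewrite !inE.
  congr (des _ _ == _); apply/funext => i; rewrite /perm_seq.
  by case: insub => [k'|]; rewrite ?oppr0.
Qed.

End Bridge.

(** * Measurability and averaging over a finite group *)

Lemma measurable_coord {R : realType} n (c : 'I_n) :
  measurable_fun [set: borel_rV R n] (fun v : 'rV[R]_n => v 0 c).
Proof.
apply: (measurability _ (RGenOpens.measurableE R)) => _ [_ [a [b ->] <-]].
rewrite setTI; apply: sub_sigma_algebra.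
apply: open_comp; last exact: interval_open.
by move=> x _; exact: coord_continuous.
Qed.

(** The event is a finite union, over the sets satisfying [Q], of finite intersections. *)
Lemma measurable_finite_bool {disp} {T : measurableType disp} {I : finType}
    (b : I -> T -> bool) (Q : pred {set I}) :
  (forall i, measurable [set w | b i w]) ->
  measurable [set w | Q [set i | b i w]%SET].
Proof.
move=> mb.
have -> : [set w | Q [set i | b i w]%SET] =
    \bigcup_(A in [set A | Q A]) \bigcap_(i in setT) [set w | (i \in A) = b i w].
  rewrite predeqE => w; split=> [Qw|[A QA wA]] /=.
    by exists [set i | b i w]%SET => // i _ /=; rewrite inE.
  suff <- : A = [set i | b i w]%SET by [].
  by apply/setP => i; rewrite inE; exact: wA.
apply: fin_bigcup_measurable => // A _.
apply: fin_bigcap_measurable => // i _.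
case: (i \in A); first by rewrite (_ : mkset _ = [set w | b i w]) // predeqE => w /=; split.
rewrite (_ : mkset _ = ~` [set w | b i w]); first exact: measurableC.
by rewrite predeqE => w /=; split=> [<-//|/negP/negPf ->].
Qed.

Section Measurability.
Context {R : realType} {disp} {T : measurableType disp} {n d : nat}.
Variable X : 'I_n -> T -> 'rV[R]_d.+1.
Hypothesis mX : forall i c, measurable_fun setT (fun w => X i w 0 c).

Lemma measurable_cramer (i : 'I_d.+2) :
  measurable_fun setT (fun w => cramer (partial_sums (X^~ w)) i).
Proof.
apply: measurable_funM; first exact: measurable_cst.
apply: measurable_sum => s; apply: measurable_funM; first exact: measurable_cst.
apply: measurable_prod => j _.
rewrite (_ : (fun w => _) = (fun w => \sum_(k < n)
    (if (k < (lift i j).+1)%N then X k w 0 (s j) else 0))); last first.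
  by apply/funext => w; rewrite !mxE summxE [LHS]big_mkcond.
by apply: measurable_sum => k; case: (k < _)%N => //; exact: measurable_cst.
Qed.

Lemma measurable_type_count t :
  measurable [set w | type_count t (fun i : 'I_d.+2 => 0 < cramer (partial_sums (X^~ w)) i)].
Proof.
pose b (i : 'I_d.+2) w := 0 < cramer (partial_sums (X^~ w)) i.
have := measurable_finite_bool b (fun A : {set 'I_d.+2} => type_count t (fun i => i \in A)).
rewrite (_ : mkset _ = [set w | type_count t (b^~ w)]); last first.
  rewrite predeqE => w /=; rewrite (_ : (fun i => i \in _) = b^~ w) //.
  by apply/funext => i; rewrite inE.
apply=> i; rewrite -[X in measurable X]setTI.
have := measurable_fun_ltr (measurable_cst (0 : R)) (measurable_cramer i).
by move=> /(_ measurableT [set true] I); rewrite preimage_true.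
Qed.

Lemma measurable_cramer_eq0 :
  measurable [set w | exists i : 'I_d.+2, cramer (partial_sums (X^~ w)) i = 0].
Proof.
rewrite (_ : mkset _ = \bigcup_(i in setT)
    [set w | cramer (partial_sums (X^~ w)) i = 0]); last first.
  by rewrite predeqE => w; split=> [[i]|[i _]]; exists i.
apply: fin_bigcup_measurable => // i _; rewrite -[X in measurable X]setTI.
exact: (measurable_cramer i measurableT [set 0] (measurable_set1 0)).
Qed.

End Measurability.

Section Law.
Context {R : realType} {disp} {T : measurableType disp} (P : probability T R) {n d : nat}.
Implicit Types X Y : 'I_n -> T -> 'rV[R]_d.+1.

Lemma measurable_random_coord X : random_vectors X ->
  forall i c, measurable_fun setT (fun w => X i w 0 c).
Proof.
by move=> mX i c; apply: (measurableT_comp (measurable_coord _ c) (mX i)).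
Qed.

(** The coordinate process on tuples: applied to it, the measurability lemmas yield the sets of
    tuples on which [same_law] is tested. *)
Let proj (i : 'I_n) (t : n.-tuple (borel_rV R d.+1)) : 'rV[R]_d.+1 := tnth t i.

Lemma measurable_proj_coord i c : measurable_fun setT (fun t => proj i t 0 c).
Proof. exact: (measurableT_comp (measurable_coord _ c) (measurable_tnth i)). Qed.

Lemma proj_joint X w : proj^~ (joint X w) = X^~ w.
Proof. by apply/funext => i; rewrite /proj tnth_mktuple. Qed.

Lemma same_law_type X Y t : same_law P Y X ->
  P [set w | type_count t (fun i : 'I_d.+2 => 0 < cramer (partial_sums (Y^~ w)) i)] =
  P [set w | type_count t (fun i : 'I_d.+2 => 0 < cramer (partial_sums (X^~ w)) i)].
Proof.
move=> /(_ _ (measurable_type_count _ measurable_proj_coord t)).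
rewrite /pushforward /=; congr (P _ = P _); rewrite predeqE => w /=;
  by rewrite proj_joint.
Qed.

Lemma same_law_cramer X Y : random_vectors X -> same_law P Y X ->
  {ae P, forall w, forall i : 'I_d.+2, cramer (partial_sums (X^~ w)) i != 0} ->
  (forall i c, measurable_fun setT (fun w => Y i w 0 c)) ->
  {ae P, forall w, forall i : 'I_d.+2, cramer (partial_sums (Y^~ w)) i != 0}.
Proof.
move=> mX YX aeX mY.
have setE (Z : 'I_n -> T -> 'rV[R]_d.+1) : ~` [set w | forall i : 'I_d.+2, cramer (partial_sums (Z^~ w)) i != 0] =
    [set w | exists i : 'I_d.+2, cramer (partial_sums (Z^~ w)) i = 0] :> set T.
  rewrite predeqE => w /=; split=> [/existsNP[i /negP/negPn/eqP h]|[i h] /(_ i)].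
    by exists i.
  by rewrite h eqxx.
change (P.-negligible (~` [set w | forall i : 'I_d.+2, cramer (partial_sums (Y^~ w)) i != 0])).
rewrite setE.
apply/negligibleP; first exact: measurable_cramer_eq0.
have := YX _ (measurable_cramer_eq0 _ measurable_proj_coord).
rewrite /pushforward /=.
have prE (Z : 'I_n -> T -> 'rV[R]_d.+1) : joint Z @^-1` [set t | exists i : 'I_d.+2, cramer (partial_sums (proj^~ t)) i = 0] =
    [set w | exists i : 'I_d.+2, cramer (partial_sums (Z^~ w)) i = 0].
  by rewrite predeqE => w /=; rewrite proj_joint.
rewrite !prE => ->; apply/negligibleP; last by rewrite -setE.
exact: (measurable_cramer_eq0 _ (measurable_random_coord _ mX)).
Qed.

End Law.

(** Integrate the sum of the indicators of the events [q g] in two ways: it is almost surely N, and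
    its integral is [#|G|] times [P E]. *)
Lemma probability_average {R : realType} {disp} {T : measurableType disp}
    (P : probability T R) {G : finType} (q : G -> T -> bool) (E : set T) (N : nat) :
  (0 < #|G|)%N -> (forall g, measurable [set w | q g w]) ->
  (forall g, P [set w | q g w] = P E) ->
  {ae P, forall w, #|[pred g | q g w]| = N} ->
  P E = (N%:R / #|G|%:R)%:E.
Proof.
move=> G0 mq qE qN.
have : (\int[P]_w (\sum_(g : G) (\1_[set w | q g w] w)%:E) = \int[P]_w (cst N%:R%:E w))%E.
  apply: ge0_ae_eq_integral => //.
  - apply: emeasurable_sum => g; apply/measurable_EFinP.
    exact: measurable_indic.
  - by move=> w _; apply: sume_ge0 => g _; rewrite lee_fin.
  - by move=> w _; rewrite /= lee_fin.
  - apply: filterS qN => w <- _ /=.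
    rewrite sumEFin; congr (_%:E); rewrite -sum1_card natr_sum [RHS]big_mkcond.
    apply: eq_bigr => g _; rewrite indicE inE.
    by case: (boolP (q g w)) => h; [rewrite mem_set|rewrite memNset //; exact/negP].
rewrite integral_cst // [X in (_ * X)%E](probability_setT P) mule1 ge0_integral_sum //; first last.
- by move=> g; apply/measurable_EFinP; exact: measurable_indic.
have intE g : (\int[P]_w (\1_[set w | q g w] w)%:E = P E)%E.
  by rewrite integral_indic // setIT; exact: qE.
rewrite (eq_bigr _ (fun g _ => intE g)).
have -> : P E = (fine (P E))%:E by rewrite fineK // -(qE (enum_val (Ordinal G0))); exact: fin_num_measure.
rewrite sumEFin sumr_const => -[] h; congr (_%:E).
by rewrite -h -[_ *+ _](mulr_natr (fine (P E))) mulfK // pnatr_eq0 -lt0n.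
Qed.

(** * The distribution of the type *)

Lemma ae_general_position {R : realType} {disp} {T : measurableType disp}
    (P : probability T R) {d} (v : T -> 'I_d.+2 -> 'rV[R]_d.+1) :
  (forall f : 'I_d.+1 -> 'I_d.+2, increasing_idx f ->
      {ae P, forall w, lin_indep (fun k => v w (f k))}) ->
  {ae P, forall w, general_position (v w)}.
Proof.
move=> h.
(* Finite functions form a finite type, so the quantifier can be moved inside the almost sure
   statement. *)
have : {ae P, forall w, forall f : {ffun 'I_d.+1 -> 'I_d.+2},
    increasing_idx f -> lin_indep (fun k => v w (f k))}.
  apply: filter_forall => f.
  have [fi|fi] := pselect (increasing_idx f); last by apply: aeW.
  by apply: filterS (h f fi) => w.
apply: filterS => w hw f fi; have fE : finfun f = f :> (_ -> _).
  by apply/funext => i; rewrite ffunE.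
by have := hw (finfun f); rewrite fE; apply.
Qed.

(** Common to both models: [K] is the almost sure constraint (zero total for bridges, trivial for
    walks) and [C] the cone as stated. The measurable event required by [has_prob] is the sign count
    of the Cramer coefficients. *)
Lemma has_prob_type {R : realType} {disp} {T : measurableType disp} (P : probability T R)
    {n d : nat} (X : 'I_n -> T -> 'rV[R]_d.+1) {G : finType}
    (act : G -> ('I_n -> 'rV[R]_d.+1) -> ('I_n -> 'rV[R]_d.+1))
    (K : ('I_n -> 'rV[R]_d.+1) -> Prop) (t N : nat) (m : int)
    (C : ('I_n -> 'rV[R]_d.+1) -> set 'rV[R]_d.+1) :
  (0 < #|G|)%N -> m + 1 = t%:Z -> (t <= d.+2)%N ->
  random_vectors X ->
  (forall g i c, measurable_fun setT (fun w => act g (X^~ w) i 0 c)) ->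
  (forall g, same_law P (fun i w => act g (X^~ w) i) X) ->
  {ae P, forall w, general_position (partial_sums (X^~ w) : 'I_d.+2 -> _)} ->
  {ae P, forall w, K (X^~ w)} ->
  (forall x, K x -> C x = pos_hull (partial_sums x : 'I_d.+2 -> _)) ->
  (forall x, K x ->
    (forall g (i : 'I_d.+2), cramer (partial_sums (act g x)) i != 0) ->
    #|[pred g | type_count t (fun i : 'I_d.+2 => 0 < cramer (partial_sums (act g x)) i)]| = N) ->
  has_prob P [set w | spherical_type m (C (X^~ w) `&` unit_sphere)] (N%:R / #|G|%:R).
Proof.
move=> G0 mt td mX mact law gp aeK CE count.
pose q g w := type_count t (fun i : 'I_d.+2 => 0 < cramer (partial_sums (act g (X^~ w))) i).
exists [set w | type_count t (fun i : 'I_d.+2 => 0 < cramer (partial_sums (X^~ w)) i)]; split.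
- exact: (measurable_type_count _ (measurable_random_coord _ mX)).
- apply: filterS2 gp aeK => w gpw Kw /=; rewrite CE //.
  exact: spherical_typeP.
apply: (probability_average P q) => //.
- by move=> g; exact: (measurable_type_count _ (mact g)).
- by move=> g; exact: (same_law_type P X _ t (law g)).
have aeX : {ae P, forall w, forall i : 'I_d.+2, cramer (partial_sums (X^~ w)) i != 0}.
  by apply: filterS gp => w gpw i; exact: general_position_cramer.
have aeG : {ae P, forall w, forall g, forall i : 'I_d.+2,
    cramer (partial_sums (act g (X^~ w))) i != 0}.
  apply: filter_forall => g; exact: (same_law_cramer P X _ mX (law g) aeX (mact g)).
by apply: filterS2 aeK aeG => w Kw gw; exact: count.
Qed.

Lemma pos_hull_drop0 {R : realType} {n k} (v : 'I_k.+1 -> 'rV[R]_n) :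
  v ord_max = 0 -> pos_hull v = pos_hull (fun i : 'I_k => v (widen_ord (leqnSn k) i)).
Proof.
move=> v0; apply/seteqP; split=> x [l [l0 ->]].
  exists (fun i => l (widen_ord (leqnSn k) i)); split=> //.
  by rewrite big_ord_recr /= v0 scaler0 addr0.
exists (fun i => if unlift ord_max i is Some j then l j else 0); split=> [i|].
  by case: unlift.
rewrite [RHS]big_ord_recr /= v0 scaler0 addr0; apply: eq_bigr => i _.
by rewrite (_ : widen_ord _ i = lift ord_max i) ?liftK //; apply/val_inj/esym/lift_max.
Qed.

Theorem theorem4p5 (R : realType) (d : nat) (d_ge1 : (1 <= d)%N) :
  (forall (disp : measure_display) (T : measurableType disp)
      (P : probability T R) (X : 'I_d.+3 -> T -> 'rV[R]_d.+1),
    random_vectors X ->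
    exchangeable P X ->
    {ae P, forall w, psum X d.+3 w = 0} ->
    (forall f : 'I_d.+1 -> 'I_d.+2, increasing_idx f ->
      {ae P, forall w, lin_indep (fun k => psum X (f k).+1 w)}) ->
    forall m : int, -1 <= m <= (d./2)%:Z ->
      has_prob P
        [set w | spherical_type m
          (pos_hull (fun k : 'I_d.+3 => psum X k.+1 w) `&` unit_sphere)]
        ((eta_mult d m)%:R * (1 / (d.+3)`!%:R) * (eulerian d.+3 `|(m + 1)%R|%N)%:R))
  /\
  (forall (disp : measure_display) (T : measurableType disp)
      (P : probability T R) (X : 'I_d.+2 -> T -> 'rV[R]_d.+1),
    random_vectors X ->
    sign_exchangeable P X ->
    (forall f : 'I_d.+1 -> 'I_d.+2, increasing_idx f ->
      {ae P, forall w, lin_indep (fun k => psum X (f k).+1 w)}) ->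
    forall m : int, -1 <= m <= (d./2)%:Z ->
      has_prob P
        [set w | spherical_type m
          (pos_hull (fun k : 'I_d.+2 => psum X k.+1 w) `&` unit_sphere)]
        ((eta_mult d m)%:R * (1 / (2 ^+ d.+2 * (d.+2)`!%:R))
          * eulerianB R d.+2 `|(m + 1)%R|%N)).
Proof.
(* The descent number is t = m + 1, and m = d/2 amounts to 2t = d + 2. *)
have etaE (m : int) : -1 <= m <= (d./2)%:Z -> exists t,
    [/\ m + 1 = t%:Z, (t <= d.+2)%N, `|(m + 1)%R|%N = t &
      eta_mult d m = (if (t * 2 == d.+2)%N then 1 else 2)%N].
  move=> md; exists `|(m + 1)%R|%N.
  have mt : m + 1 = `|(m + 1)%R|%N by lia.
  split=> //; first lia.
  by rewrite /eta_mult; congr (if _ then _ else _); lia.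
split=> disp T P X mX ex.
  move=> aeS0 gp m /etaE[t [mt td -> ->]].
  rewrite [X in has_prob _ _ X](_ : _ =
      ((if (t * 2 == d.+2)%N then 1 else 2) * eulerian d.+3 t)%N%:R / #|{: 'S_d.+3}|%:R); last first.
    by rewrite card_Sn natrM div1r mulrAC.
  apply: (has_prob_type P X (fun (s : 'S_d.+3) x => x \o s)
    (fun x => \sum_i x i = 0) t _ m
    (fun x => pos_hull (partial_sums x : 'I_d.+3 -> _))) => //.
  - by rewrite card_Sn fact_gt0.
  - by move=> s i c; exact: measurable_random_coord.
  - exact: (ae_general_position P (fun w => partial_sums (X^~ w)) gp).
  - apply: filterS aeS0 => w S0; rewrite -[RHS]S0.
    by apply: eq_bigl => i; rewrite ltn_ord.
  (* The last partial sum of a bridge is 0 and contributes nothing to the cone. *)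
  - move=> x x0; rewrite pos_hull_drop0 // /partial_sums -[RHS]x0.
    by apply: eq_bigl => i; rewrite ltn_ord.
  - by move=> x x0 gpx; exact: card_bridge_type.
move=> gp m /etaE[t [mt td -> ->]].
rewrite eulerianBE [X in has_prob _ _ X](_ : _ =
    ((if (t * 2 == d.+2)%N then 1 else 2) * signed_eulerian d.+2 t)%N%:R /
    #|{: 'S_d.+2 * {ffun 'I_d.+2 -> bool}}|%:R); last first.
  rewrite card_prod card_Sn card_ffun card_bool card_ord natrM div1r mulrAC.
  by rewrite natrM natrX [(_ `!)%:R * _]mulrC.
apply: (has_prob_type P X (fun g x => signed_act x g) (fun=> True) t _ m
  (fun x => pos_hull (partial_sums x : 'I_d.+2 -> _))) => //.
- by rewrite card_prod card_Sn card_ffun muln_gt0 fact_gt0 card_bool expn_gt0.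
- move=> g i c; rewrite (_ : (fun w => _) = (fun w => (-1) ^+ g.2 i * X (g.1 i) w 0 c)).
    apply: measurable_funM; first exact: measurable_cst.
    exact: measurable_random_coord.
  by apply/funext => w; rewrite /signed_act mxE.
- by move=> [s e]; exact: ex.
- exact: (ae_general_position P (fun w => partial_sums (X^~ w)) gp).
- exact: aeW.
- by move=> x _ gpx; exact: card_walk_type.
Qed.
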